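(* Let $m_1,m_2,m_3$ be positive integers and let $G=Q^{\mathrm{Klein}}_{2m_1,2m_2,2m_3}$ be the three-dimensional Klein grid graph with the boustrophedon labelling and the orientation $\mathcal{O}$ described below. Give every vertex weight $x$, and weights $a_1,a_2,a_3$ to the edges along the first, second, third coordinate direction respectively (dashed edges counting as first direction). Then the partition function of the monopole-dimer (loop-vertex) model on $(G,\mathcal{O})$ is $$\prod_{i_1=1}^{m_1}\prod_{i_2=1}^{m_2}\prod_{i_3=1}^{m_3}\Big(x^2+4a_1^2\sin^2\frac{(4i_1-1)\pi}{4m_1}+4a_2^2\sin^2\frac{(2i_2-1)\pi}{2m_2}+4a_3^2\sin^2\frac{(2i_3-1)\pi}{2m_3}\Big)^{4}.$$
   Context: $P_n$ is the path on $1,\dots,n$ and $C_n$ the cycle on $1,\dots,n$. $P_{n_1}\square C_{n_2}\square C_{n_3}$ has vertex set $[n_1]\times[n_2]\times[n_3]$, two vertices adjacent iff they differ in exactly one coordinate and those coordinates are adjacent in the corresponding factor (edge ''along'' that direction). The Klein grid graph $Q^{\mathrm{Klein}}_{n_1,n_2,n_3}$ is $P_{n_1}\square C_{n_2}\square C_{n_3}$ (''solid edges'') plus, for all $k_2\in[n_2],k_3\in[n_3]$, a ''dashed edge'' between $(1,k_2,k_3)$ and $(n_1,n_2-k_2+1,n_3-k_3+1)$. Boustrophedon labelling of $[2m_1]\times[2m_2]\times[2m_3]$: vertex $(p,q,r)$ gets label $8tm_1m_2+4sm_1+p$ if $q=2s+1,r=2t+1$; $8tm_1m_2+4sm_1-p+1$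 if $q=2s,r=2t+1$; $8tm_1m_2-4sm_1-p+1$ if $q=2s+1,r=2t$; $8tm_1m_2-4sm_1+p$ if $q=2s,r=2t$. Orientation $\mathcal{O}$: solid edges are directed from lower to higher label; the dashed edge at the vertex labelled $1$ is directed away from it; the remaining dashed edges are directed so that every two-dimensional square (4-cycle formed by two dashed edges and the solid edges joining their endpoints) has an odd number of edges directed along each of its two traversal directions (clockwise-odd property). Loop-vertex (monopole-dimer) model on $(G,\mathcal{O})$ with vertex weights $x(v)$ and edge weights $a_{v,v'}=a_{v',v}$: $\mathrm{sgn}(v,v')=1$ if $v\to v'$ and $-1$ if $v'\to v$. A configuration is a collection of vertex-disjoint directed cycles of even length $\ge4$ (two directions distinct), doubled edges and isolated vertices covering each vertex exactly once. A loop $(v_0,\dots,v_{2k}=v_0)$ has weight $-\prod_{i=0}^{2k-1}\mathrm{sgn}(v_i,v_{i+1})a_{v_i,v_{i+1}}$ (a doubled edge $\{u,v\}$ has weight $a_{u,v}^2$); a configuration has weight the product of its loop weights and of $x(v)$ over isolated vertices; the partition function is the sum of weights of all configurations.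
   Formalization: When m_2=1 (or m_3=1) the formal statement takes C_2 as two parallel edges merged into a single edge of weight 2a_2 (or 2a_3); with a single edge of weight a_2 (or a_3) the printed formula fails. For m_2,m_3 at least 2 the weights are as stated. *)

(* Defs.v *)
From HB Require Import structures.
From mathcomp Require Import all_boot all_order all_algebra.
From mathcomp Require Import boolp reals trigo.
From mathcomp Require Import zify.

Set Implicit Arguments.
Unset Strict Implicit.
Unset Printing Implicit Defensive.

Import Order.TTheory GRing.Theory Num.Theory.

(** * The loop-vertex (monopole-dimer) model on an oriented weighted graph *)

Section LoopVertexModel.
Variables (R : realType) (V : finType).
(* [e] is the adjacency relation and [o u v] means that the edge {u, v} is
   directed from u to v. *)
Variables (e o : rel V).

Definition orientation : Prop :=
  (forall u v : V, o u v -> e u v) /\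
  (forall u v : V, e u v -> o u v (+) o v u).

(* A directed cycle is represented by its set of arcs, so that rotating the
   sequence of vertices gives the same cycle, whereas reversing it gives a
   different one as soon as its length is at least 3. *)
Definition arcs (c : seq V) : {set V * V} := [set (v, next c v) | v in c].

Definition even_loop (A : {set V * V}) : Prop :=
  exists c : seq V,
    [/\ ucycle e c, ~~ odd (size c), (4 <= size c)%N & A = arcs c].

Definition loop_support (A : {set V * V}) : {set V} := [set p.1 | p in A].

Definition graph_edge (D : {set V}) : Prop :=
  exists u v : V, e u v /\ D = [set u; v].

(* The directed loops, the doubled edges and the isolated vertices. *)
Definition lv_collection : finType :=
  ({set {set V * V}} * {set {set V}} * {set V})%type.

Definition loops (C : lv_collection) : {set {set V * V}} := C.1.1.
Definition doubled (C : lv_collection) : {set {set V}} := C.1.2.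
Definition isolated (C : lv_collection) : {set V} := C.2.

Definition lv_configuration (C : lv_collection) : Prop :=
  [/\ forall A, A \in loops C -> even_loop A,
      forall D, D \in doubled C -> graph_edge D
    & forall v : V,
        (#|[set A in loops C | v \in loop_support A]|
         + #|[set D in doubled C | v \in D]| + (v \in isolated C) = 1)%N].

Local Open Scope ring_scope.

Variables (x : V -> R) (a : V -> V -> R).

Definition sgn (u v : V) : R := if o u v then 1 else -1.

Definition loop_weight (A : {set V * V}) : R :=
  - \prod_(p in A) (sgn p.1 p.2 * a p.1 p.2).

(* If D = {u, v} with u <> v and [a] is symmetric, the product below ranges
   over (u, v) and (v, u), and is a u v ^+ 2. *)
Definition doubled_weight (D : {set V}) : R :=
  \prod_(p | [&& p.1 \in D, p.2 \in D & p.1 != p.2]) a p.1 p.2.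

Definition lv_weight (C : lv_collection) : R :=
  (\prod_(A in loops C) loop_weight A) *
  (\prod_(D in doubled C) doubled_weight D) *
  (\prod_(v in isolated C) x v).

Definition lv_partition_function : R :=
  \sum_(C : lv_collection | `[< lv_configuration C >]) lv_weight C.

End LoopVertexModel.

(** * The Klein grid graph *)

Section KleinGrid.
Variables (n1 n2 n3 : nat).

(* Coordinates are 0-based: the vertex (k1, k2, k3) of [n1] x [n2] x [n3] is
   encoded by ordinals of values k1 - 1, k2 - 1 and k3 - 1. *)
Definition klein_vertex : finType := ('I_n1 * 'I_n2 * 'I_n3)%type.

Implicit Types u v : klein_vertex.

Definition path_adj n (i j : 'I_n) : bool :=
  (val j == (val i).+1) || (val i == (val j).+1).

(* The number of edges of the cycle C_n, whose n edges join i to i + 1 mod n,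
   that have ends i and j. For n >= 3 it is 0 or 1; C_2 has two parallel
   edges. *)
Definition cycle_mult n (i j : 'I_n) : nat := (j == ordS i) + (i == ordS j).

Definition cycle_adj n (i j : 'I_n) : bool := (0 < cycle_mult i j)%N.

Definition solid1 u v :=
  [&& path_adj u.1.1 v.1.1, u.1.2 == v.1.2 & u.2 == v.2].
Definition solid2 u v :=
  [&& u.1.1 == v.1.1, cycle_adj u.1.2 v.1.2 & u.2 == v.2].
Definition solid3 u v :=
  [&& u.1.1 == v.1.1, u.1.2 == v.1.2 & cycle_adj u.2 v.2].
Definition solid u v := [|| solid1 u v, solid2 u v | solid3 u v].

(* [rev_ord] is k |-> n - k + 1 on 1-based coordinates. *)
Definition dashed_from u v :=
  [&& val u.1.1 == 0, (val v.1.1).+1 == n1,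
      v.1.2 == rev_ord u.1.2 & v.2 == rev_ord u.2].
Definition dashed u v := dashed_from u v || dashed_from v u.

Definition klein_adj u v := solid u v || dashed u v.

(* Parallel edges (which only occur along a factor C_2) are merged into one
   edge carrying the sum of their weights. *)
Definition klein_weight (R : realType) (a1 a2 a3 : R) u v : R :=
  if solid1 u v || dashed u v then a1
  else if solid2 u v then (a2 *+ cycle_mult u.1.2 v.1.2)%R
  else if solid3 u v then (a3 *+ cycle_mult u.2 v.2)%R
  else 0%R.

End KleinGrid.

(** * The boustrophedon labelling and the orientation *)

(* (p, q, r) are 1-based coordinates; for q = 2s or q = 2s + 1, q./2 is s. The
   subtractions do not truncate on [2m1] x [2m2] x [2m3]. *)
Definition boustrophedon (m1 m2 p q r : nat) : nat :=
  let s := q./2 in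
  let t := r./2 in
  if odd r then
    if odd q then 8 * t * m1 * m2 + 4 * s * m1 + p
    else 8 * t * m1 * m2 + 4 * s * m1 - p + 1
  else
    if odd q then 8 * t * m1 * m2 - 4 * s * m1 - p + 1
    else 8 * t * m1 * m2 - 4 * s * m1 + p.

Section KleinOrientation.
Variables (m1 m2 m3 : nat).
Local Notation V := (klein_vertex (2 * m1) (2 * m2) (2 * m3)).
Implicit Types u v w z : V.

Definition label v : nat :=
  boustrophedon m1 m2 (val v.1.1).+1 (val v.1.2).+1 (val v.2).+1.

Definition directed_edges (o : rel V) u v w z : nat :=
  o u v + o v w + o w z + o z u.

(* In [clockwise_odd] the square is traversed as u, v, w, z; its other
   traversal v, u, z, w is another instance of the quantifiers. *)
Definition clockwise_odd (o : rel V) : Prop :=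
  forall u v w z,
    solid u v -> dashed v w -> solid w z -> dashed z u ->
    odd (directed_edges o u v w z).

Definition klein_orientation (o : rel V) : Prop :=
  [/\ orientation (@klein_adj (2 * m1) (2 * m2) (2 * m3)) o,
      forall u v, solid u v -> o u v = (label u < label v)%N,
      forall u v, dashed u v -> label u = 1%N -> o u v
    & clockwise_odd o].

End KleinOrientation.

(** * Existence of the orientation *)

Lemma boustrophedon_row m1 m2 p q r :
  0 < p <= 2 * m1 -> 0 < q <= 2 * m2 -> 0 < r ->
  let T := 8 * r./2 * m1 * m2 in
  let b := boustrophedon m1 m2 p q r in
  if odd r then T + 2 * m1 * q.-1 < b <= T + 2 * m1 * q
  else (4 * m1 * m2 <= T - 2 * m1 * q + 4 * m1 * m2) &&
       (T - 2 * m1 * q < b <= T - 2 * m1 * q.-1).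
Proof.
move=> hp hq hr /=; rewrite /boustrophedon.
have [s Es] : {s | s = q./2} by exists q./2.
have [t Et] : {t | t = r./2} by exists r./2.
have Eq := odd_double_half q; have Er := odd_double_half r.
rewrite -Es -Et -!muln2 in Eq Er *.
have E8 : 8 * t * m1 * m2 = 8 * (t * (m1 * m2)) by lia.
have E4 : 4 * s * m1 = 4 * (s * m1) by lia.
rewrite E8 E4.
case: (odd q) Eq => /= Eq; case: (odd r) Er => /= Er.
- have -> : q.-1 = 2 * s by lia.
  by rewrite -Eq; nia.
- have ht : m1 * m2 <= t * (m1 * m2) by nia.
  have hs : s * m1 + m1 <= m1 * m2 by nia.
  have -> : q.-1 = 2 * s by lia.
  rewrite -Eq; nia.
- have hs : m1 <= s * m1 by nia.
  have -> : q.-1 = 2 * s - 1 by lia.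
  rewrite -Eq; nia.
- have ht : m1 * m2 <= t * (m1 * m2) by nia.
  have hs0 : m1 <= s * m1 by nia.
  have hs : s * m1 <= m1 * m2 by nia.
  have -> : q.-1 = 2 * s - 1 by lia.
  rewrite -Eq; nia.
Qed.

Lemma boustrophedon_layer m1 m2 p q r :
  0 < p <= 2 * m1 -> 0 < q <= 2 * m2 -> 0 < r ->
  4 * m1 * m2 * r.-1 < boustrophedon m1 m2 p q r <= 4 * m1 * m2 * r.
Proof.
move=> hp hq hr; have := boustrophedon_row hp hq hr => /=.
set b := boustrophedon _ _ _ _ _.
have Er := odd_double_half r.
have h1 : m1 * q <= m1 * (2 * m2) by rewrite leq_mul2l; lia.
have h2 : m1 * q.-1 + m1 = m1 * q by nia.
have E8 t : 8 * t * m1 * m2 = 8 * (m1 * m2 * t) by nia.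
rewrite E8 -muln2 in Er *.
case: (odd r) Er => /= Er.
- have -> : r.-1 = 2 * r./2 by lia.
  rewrite -[in X in _ -> X]Er; nia.
- have ht : 0 < r./2 by lia.
  have -> : r.-1 = 2 * r./2 - 1 by lia.
  rewrite -[in X in _ -> X]Er; nia.
Qed.

Lemma boustrophedon_lt1 m1 m2 p p' q r :
  0 < p <= 2 * m1 -> 0 < p' <= 2 * m1 -> 0 < q <= 2 * m2 -> 0 < r ->
  (boustrophedon m1 m2 p q r < boustrophedon m1 m2 p' q r) =
  (if odd q == odd r then p < p' else p' < p).
Proof.
move=> hp hp' hq hr; rewrite /boustrophedon.
have Eq := odd_double_half q; have Er := odd_double_half r.
have E8 t : 8 * t * m1 * m2 = 8 * (t * (m1 * m2)) by lia.
have E4 t : 4 * t * m1 = 4 * (t * m1) by lia.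
rewrite E8 E4; move: Eq Er; move: (q./2) (r./2) => s t.
rewrite -!muln2.
case: (odd q) => /= Eq; case: (odd r) => /= Er.
- lia.
- have ht : m1 * m2 <= t * (m1 * m2) by nia.
  have hs : s * m1 + m1 <= m1 * m2 by nia.
  lia.
- have hs : m1 <= s * m1 by nia.
  lia.
- have ht : m1 * m2 <= t * (m1 * m2) by nia.
  have hs : s * m1 <= m1 * m2 by nia.
  lia.
Qed.

Lemma boustrophedon_lt2 m1 m2 p q q' r :
  0 < p <= 2 * m1 -> 0 < q <= 2 * m2 -> 0 < q' <= 2 * m2 -> 0 < r ->
  q != q' ->
  (boustrophedon m1 m2 p q r < boustrophedon m1 m2 p q' r) =
  (if odd r then q < q' else q' < q).
Proof.
move=> hp hq hq' hr hqq.
have := boustrophedon_row hp hq hr; have := boustrophedon_row hp hq' hr => /=.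
set b := boustrophedon _ _ _ _ _; set b' := boustrophedon _ _ _ _ _.
have [h|h|h] := ltngtP q q'; last by rewrite h eqxx in hqq.
- have : 2 * m1 * q <= 2 * m1 * q'.-1 by rewrite leq_mul2l; lia.
  case: (odd r); lia.
- have : 2 * m1 * q' <= 2 * m1 * q.-1 by rewrite leq_mul2l; lia.
  case: (odd r); lia.
Qed.

Lemma boustrophedon_lt3 m1 m2 p q r r' :
  0 < p <= 2 * m1 -> 0 < q <= 2 * m2 -> 0 < r -> 0 < r' -> r != r' ->
  (boustrophedon m1 m2 p q r < boustrophedon m1 m2 p q r') = (r < r').
Proof.
move=> hp hq hr hr' hrr.
have := boustrophedon_layer hp hq hr; have := boustrophedon_layer hp hq hr'.
have [h|h|h] := ltngtP r r'; last by rewrite h eqxx in hrr.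
- have : 4 * m1 * m2 * r <= 4 * m1 * m2 * r'.-1 by rewrite leq_mul2l; lia.
  lia.
- have : 4 * m1 * m2 * r' <= 4 * m1 * m2 * r.-1 by rewrite leq_mul2l; lia.
  lia.
Qed.

Section Existence.
Variables (m1 m2 m3 : nat).
Local Notation V := (klein_vertex (2 * m1) (2 * m2) (2 * m3)).
Implicit Types u v w z : V.

Let explicit_orientation : rel V :=
  fun u v => if solid u v then label u < label v
             else dashed u v && ~~ odd u.1.2.

Lemma cycle_adjP m (i j : 'I_(2 * m)) : cycle_adj i j ->
  [/\ i != j :> nat, odd i != odd j &
   [|| j == i.+1 :> nat, i == j.+1 :> nat,
     (i == 0 :> nat) && (j.+1 == 2 * m) | (j == 0 :> nat) && (i.+1 == 2 * m)]].
Proof.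
have aux (a b : 'I_(2 * m)) : b == ordS a ->
  (b == a.+1 :> nat) || (b == 0 :> nat) && (a.+1 == 2 * m).
  move=> /eqP ->; rewrite /=.
  have := ltn_ord a; rewrite leq_eqVlt => /orP[/eqP e|h].
    by rewrite e modnn !eqxx orbT.
  by rewrite modn_small ?eqxx.
rewrite /cycle_adj /cycle_mult addn_gt0 !lt0b => h.
have := ltn_ord i; have := ltn_ord j => hj hi.
have {}h : (j == i.+1 :> nat) || (j == 0 :> nat) && (i.+1 == 2 * m) ||
   ((i == j.+1 :> nat) || (i == 0 :> nat) && (j.+1 == 2 * m)).
  by case/orP: h => /aux ->; rewrite ?orbT.
split; lia.
Qed.

Local Ltac iflia := repeat match goal with |- context [if _ then _ else _] => case: ifP => ? end; lia.

Lemma solid_label u v : solid u v ->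
  (label u < label v) =
  if u.1.2 == v.1.2 then
    if u.2 == v.2 then
      if odd u.1.2 == odd u.2 then u.1.1 < v.1.1 else v.1.1 < u.1.1
    else u.2 < v.2
  else if odd u.2 then v.1.2 < u.1.2 else u.1.2 < v.1.2.
Proof.
case: u v => [[p q] r] [[p' q'] r']; rewrite /label /=.
have := ltn_ord p; have := ltn_ord q; have := ltn_ord r.
have := ltn_ord p'; have := ltn_ord q'; have := ltn_ord r'.
move=> ??????.
rewrite /solid /solid1 /solid2 /solid3 /=.
case/or3P => /and3P[].
- move=> _ /eqP <- /eqP <-; rewrite !eqxx boustrophedon_lt1 /=; iflia.
- move=> /eqP <- h /eqP <-; have [ne od _] := cycle_adjP h.
  rewrite -val_eqE /= (negbTE ne) boustrophedon_lt2 /=; iflia.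
- move=> /eqP <- /eqP <- h; have [ne od _] := cycle_adjP h.
  rewrite -[r == r']val_eqE /= eqxx (negbTE ne) boustrophedon_lt3 /=; iflia.
Qed.

Lemma path_adjC n (i j : 'I_n) : path_adj i j = path_adj j i.
Proof. by rewrite /path_adj orbC. Qed.

Lemma cycle_adjC n (i j : 'I_n) : cycle_adj i j = cycle_adj j i.
Proof. by rewrite /cycle_adj /cycle_mult addnC. Qed.

Lemma solidC u v : solid u v = solid v u.
Proof.
rewrite /solid /solid1 /solid2 /solid3 path_adjC.
rewrite (cycle_adjC u.1.2) (cycle_adjC u.2).
by rewrite (eq_sym u.1.1) (eq_sym u.1.2) (eq_sym u.2).
Qed.

Lemma dashedP u v : dashed u v ->
  [/\ v.1.2 = rev_ord u.1.2, v.2 = rev_ord u.2 &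
    (u.1.1 == 0 :> nat) && (v.1.1.+1 == 2 * m1) ||
    (v.1.1 == 0 :> nat) && (u.1.1.+1 == 2 * m1)].
Proof.
case/orP => /and4P[h1 h2 /eqP h3 /eqP h4].
  by split=> //; rewrite h1 h2.
by rewrite h3 h4 !rev_ordK; split=> //; rewrite h1 h2 orbT.
Qed.

Lemma dashed_solid u v : dashed u v -> solid u v = false.
Proof.
move=> /dashedP[h2 h3 _]; rewrite /solid /solid1 /solid2 /solid3 h2 h3.
have /negbTE -> : u.1.2 != rev_ord u.1.2.
  by apply/eqP => /(congr1 val) /=; have := ltn_ord u.1.2; lia.
have /negbTE -> : u.2 != rev_ord u.2.
  by apply/eqP => /(congr1 val) /=; have := ltn_ord u.2; iflia.
by rewrite /= !andbF.
Qed.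

Lemma klein_orientation_exists : exists o : rel V, klein_orientation o.
Proof.
exists explicit_orientation; rewrite /explicit_orientation; split.
- split=> u v; rewrite /klein_adj.
    by case: ifP => //= _ /andP[].
  case/orP => h.
    have h' := h; rewrite solidC in h'.
    rewrite h h' !solid_label // (eq_sym v.1.2) (eq_sym v.2).
    case: u v h {h'} => [[p q] r] [[p' q'] r'].
    rewrite /solid /solid1 /solid2 /solid3 /path_adj /=.
    case/or3P => /and3P[].
    + by move=> h /eqP-> /eqP->; rewrite !eqxx; case: ifP; iflia.
    + move=> /eqP-> /cycle_adjP[ne _ _] /eqP->; rewrite -val_eqE /= (negbTE ne).
      by case: ifP; iflia.
    + move=> /eqP-> /eqP-> /cycle_adjP[ne _ _]; rewrite eqxx -val_eqE /= (negbTE ne).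
      by iflia.
  have h' : dashed v u by rewrite /dashed orbC.
  rewrite !dashed_solid // h h' /=; have [-> _ _] := dashedP h => /=.
  have -> : odd (2 * m2 - u.1.2.+1) = ~~ odd u.1.2.
    by have := ltn_ord u.1.2; lia.
  by case: odd.
- by move=> u v ->.
- move=> u v h; rewrite dashed_solid // h /= /label.
  have h1 := ltn_ord u.1.1; have h2 := ltn_ord u.1.2; have h3 := ltn_ord u.2.
  move=> lab.
  have := @boustrophedon_layer m1 m2 u.1.1.+1 u.1.2.+1 u.2.+1.
  have := @boustrophedon_row m1 m2 u.1.1.+1 u.1.2.+1 u.2.+1.
  rewrite lab => H1 H2.
  have hr : val u.2 = 0%N.
    have /andP[H _] := H2 h1 h2 isT.
    by move: H; rewrite /= ltnS leqn0 !muln_eq0 /=; iflia.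
  rewrite hr in H1 => //.
  have /andP[H _] := H1 h1 h2 isT.
  by move: H; rewrite /= !muln0 !mul0n /=; nia.
- have addbE (a b : bool) : a (+) b = (a != b) by case: a b => [] [].
  move=> u v w z suv dvw swz dzu.
  have dwv : dashed w v by rewrite /dashed orbC.
  have duz : dashed u z by rewrite /dashed orbC.
  rewrite /directed_edges suv swz (dashed_solid dvw) (dashed_solid dzu) dvw dzu.
  rewrite !solid_label // !oddD !oddb /= !addbE.
  have [w2 w3 w1] := dashedP dvw; have [z2 z3 z1] := dashedP duz.
  rewrite w2 w3 z2 z3 !(inj_eq rev_ord_inj) (eq_sym v.1.2) (eq_sym v.2).
  case: u v w z suv swz {dvw dzu dwv duz} w1 z1 w2 w3 z2 z3
    => [[p q] r] [[p' q'] r'] [[pw qw] rw] [[pz qz] rz] /=.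
  move=> suv swz hw hz _ _ _ _.
  have := ltn_ord p; have := ltn_ord q; have := ltn_ord r.
  have := ltn_ord p'; have := ltn_ord q'; have := ltn_ord r'.
  move=> b1 b2 b3 b4 b5 b6.
  move: suv; rewrite {1}/solid /solid1 /solid2 /solid3 /path_adj /=.
  case/or3P => /and3P[].
  + move=> h /eqP Eq /eqP Er; subst q' r'; rewrite !eqxx.
    have -> : (odd (2 * m2 - q.+1) == odd (2 * m3 - r.+1)) = (odd q == odd r) by iflia.
    case: ifP; iflia.
  + move=> /eqP Ep /cycle_adjP[ne od cy] /eqP Er; subst p' r'.
    rewrite -val_eqE /= (negbTE ne).
    have -> : odd (2 * m3 - r.+1) = ~~ odd r by lia.
    have -> : odd (2 * m2 - q.+1) = ~~ odd q by lia.
    have -> : odd q' = ~~ odd q by case: (odd q) od; case: (odd q').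
    have -> : (2 * m2 - q'.+1 < 2 * m2 - q.+1) = (q < q') by lia.
    have -> : (2 * m2 - q.+1 < 2 * m2 - q'.+1) = (q' < q) by lia.
    by case: (odd q); case: (odd r); case: ltngtP ne.
  + move=> /eqP Ep /eqP Eq /cycle_adjP[ne od cy]; subst p' q'.
    rewrite eqxx -val_eqE /= (negbTE ne).
    have -> : odd (2 * m2 - q.+1) = ~~ odd q by lia.
    have -> : (2 * m3 - r'.+1 < 2 * m3 - r.+1) = (r < r') by lia.
    by case: (odd q); case: ltngtP ne.
Qed.

End Existence.

(* Main.v *)
Require Import Defs.
From mathcomp Require Import all_boot all_order all_fingroup all_algebra.
From mathcomp Require Import mxtens complex.
From mathcomp Require Import boolp reals trigo.
From mathcomp Require Import ssrAC zify ring lra.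

(** Every vertex of the Klein grid has a colour (the parity of the sum of its
    coordinates) that changes along each edge, so a permutation moving each
    vertex to itself or to a neighbour has only fixed points and even cycles;
    hence the partition function is the determinant of [x + K], with [K] the
    signed adjacency matrix.  Writing [T] for the skew path matrix on the first
    coordinate, [P] for the matrix joining its two ends, [A] for the
    antiperiodic skew cycle matrices, [s] = diag((-1)^i) and [r] for the
    reversal,
      [K = a1 (T * s * s + P * (s r) * r) + a2 (1 * A * s) + a3 (1 * 1 * A)]
    (tensor products).  The three summands anticommute, so [K^2] is the sum of
    their squares, and the first square is [a1^2 (T + P B)^2] where
    [B = 1 * r * (s r)] commutes with everything in [K^2] and [B^2 = -1].
    On the eigenspaces of [B], [T + P B] becomes the cycle matrix twisted by
    [i] or [-i], which the Vandermonde matrices of the roots of [i] and [-i]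
    diagonalize.  As [K] is skew, [det (x + K)^2 = det (x^2 - K^2)], and the
    sign of the square root is fixed by both sides being monic in [x]. *)

Set Implicit Arguments.
Unset Strict Implicit.
Unset Printing Implicit Defensive.

Import Order.TTheory GRing.Theory Num.Theory.
Local Open Scope ring_scope.

(** * Loop-vertex configurations as permutations *)

Section PermutationCycles.
Variable T : finType.
Implicit Types (s : {perm T}) (c : seq T) (v w : T).

Lemma porbit_fconnect s v w : (w \in porbit s v) = fconnect s v w.
Proof.
apply/porbitP/idP => [[i ->]|]; first by rewrite permX fconnect_iter.
by move=> /iter_findex <-; exists (findex s v w); rewrite permX.
Qed.

Lemma porbit_fcycle s c v : fcycle s c -> v \in c -> porbit s v =i c.
Proof.
by move=> cs vc w; rewrite porbit_fconnect -(fconnect_cycle cs vc).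
Qed.

Lemma mem_porbitf s v w : (s v \in porbit s w) = (v \in porbit s w).
Proof.
by rewrite -!eq_porbit_mem -[s v]/((s ^+ 1)%g v) porbit_perm.
Qed.

Lemma porbitf s v : porbit s (s v) = porbit s v.
Proof. by apply/eqP; rewrite eq_porbit_mem mem_porbitf porbit_id. Qed.

Lemma card_porbit1 s v : (#|porbit s v| == 1)%N = (s v == v).
Proof.
apply/idP/eqP => [/cards1P[w E]|sv].
  have := porbit_id s v; have := porbit_id s (s v); rewrite porbitf E.
  by rewrite !inE => /eqP -> /eqP.
have cs : fcycle s [:: v] by rewrite /= sv eqxx.
by rewrite (eq_card (porbit_fcycle cs (mem_head _ _))) (card_uniqP _).
Qed.

Lemma porbit2 s v : s v != v -> s (s v) = v -> porbit s v = [set v; s v].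
Proof.
move=> nv ssv; apply/setP => w.
have cs : fcycle s [:: v; s v] by rewrite /= ssv !eqxx.
by rewrite (porbit_fcycle cs (mem_head _ _)) !inE.
Qed.

Lemma card_porbit2 s v :
  (#|porbit s v| == 2)%N = (s v != v) && (s (s v) == v).
Proof.
apply/idP/andP => [E|[nv /eqP ssv]]; last by rewrite porbit2 // cards2 [v == _]eq_sym nv.
have nv : s v != v by rewrite -card_porbit1 (eqP E).
by split=> //; have := iter_porbit s v; rewrite (eqP E) /= => ->.
Qed.

Lemma porbitsP s (O : {set T}) :
  reflect (exists v, O = porbit s v) (O \in porbits s).
Proof. by apply: (iffP imsetP) => [[v _ ->]|[v ->]]; exists v. Qed.

Lemma mem_porbits s (O : {set T}) v :
  O \in porbits s -> v \in O -> O = porbit s v.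
Proof.
by case/porbitsP => w -> vw; apply/eqP; rewrite eq_sym eq_porbit_mem.
Qed.

Lemma partition_porbits (R : Type) (idx : R) (op : Monoid.com_law idx)
    s (F : T -> R) :
  \big[op/idx]_v F v = \big[op/idx]_(O in porbits s) \big[op/idx]_(v in O) F v.
Proof.
rewrite (partition_big (porbit s) (mem (porbits s))) => [|v _] /=; last first.
  by apply/porbitsP; exists v.
apply: eq_bigr => O OP; apply: eq_bigl => v.
apply/eqP/idP => [<-|]; first exact: porbit_id.
by move/(mem_porbits OP).
Qed.

(** The parity of [s] is that of [#|T|] plus the number of orbits, and [#|T|] is the sum of the
    orbit sizes. The sign thus splits over the orbits, as the weight of a configuration does. *)
Lemma odd_permE (R : pzRingType) s :
  (-1) ^+ s = \prod_(O in porbits s) (-1) ^+ #|O|.+1 :> R.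
Proof.
rewrite prodrXr -[in RHS]signr_odd; congr (_ ^+ nat_of_bool _).
have ET : #|T| = (\sum_(O in porbits s) #|O|)%N.
  rewrite -sum1_card (eq_bigl xpredT) // (partition_porbits _ s).
  by apply: eq_bigr => O _; rewrite sum1_card.
have -> : (\sum_(O in porbits s) #|O|.+1 = #|porbits s| + #|T|)%N.
  by rewrite ET -sum1_card -big_split.
by rewrite oddD addbC.
Qed.

Definition perm_arcs s (O : {set T}) : {set T * T} := [set (v, s v) | v in O].

Lemma mem_perm_arcs s O v w : ((v, w) \in perm_arcs s O) = (v \in O) && (w == s v).
Proof.
apply/imsetP/andP => [[u uO [-> ->]]|[vO /eqP ->]]; first by rewrite uO.
by exists v.
Qed.

Lemma loop_support_perm_arcs s O : loop_support (perm_arcs s O) = O.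
Proof.
rewrite /loop_support /perm_arcs -imset_comp /=.
by rewrite (eq_imset (g := id)) ?imset_id.
Qed.

Lemma mem_arcs c v w : ((v, w) \in arcs c) = (v \in c) && (w == next c v).
Proof.
apply/imsetP/andP => [[u uO [-> ->]]|[vO /eqP ->]]; first by rewrite uO.
by exists v.
Qed.

Lemma mem_loop_support c v : (v \in loop_support (arcs c)) = (v \in c).
Proof.
apply/imsetP/idP => [[[u w]]|vc].
  by rewrite mem_arcs => /andP[uc _] ->.
by exists (v, next c v); rewrite // mem_arcs vc eqxx.
Qed.

Lemma arcs_perm s c :
  {in c, forall v, s v = next c v} -> forall O : {set T}, O =i c -> perm_arcs s O = arcs c.
Proof.
move=> sc O Oc; apply/setP => -[v w]; rewrite mem_perm_arcs mem_arcs Oc.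
by case vc: (v \in c) => //=; rewrite sc.
Qed.

End PermutationCycles.

(** * The partition function of a bipartite graph as a signed sum over permutations *)

Section ModelAsDeterminant.
Variables (R : realType) (V : finType) (e o : rel V).
Variables (x : V -> R) (a : V -> V -> R) (colour : V -> bool).
Hypothesis e_sym : symmetric e.
Hypothesis e_bipartite : forall u v, e u v -> colour u != colour v.
Hypothesis o_orient : orientation e o.
Implicit Types (s t : {perm V}) (C : lv_collection V) (u v w : V).

Definition perm_config s : lv_collection V :=
  ([set perm_arcs s O | O in [set O in porbits s | (2 < #|O|)%N]],
   [set O in porbits s | #|O| == 2%N], [set v | s v == v]).

Lemma loops_perm_configP s (A : {set V * V}) :
  reflect (exists2 v, A = perm_arcs s (porbit s v) & (2 < #|porbit s v|)%N)
          (A \in loops (perm_config s)).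
Proof.
apply: (iffP imsetP) => [[O]|[v -> h]].
  by rewrite inE => /andP[/porbitsP[v ->] h] ->; exists v.
by exists (porbit s v); rewrite // inE h andbT; apply/porbitsP; exists v.
Qed.

Lemma doubled_perm_config s (D : {set V}) v :
  v \in D -> (D \in doubled (perm_config s)) = (D == porbit s v) && (#|D| == 2%N).
Proof.
move=> vD; rewrite inE; congr (_ && _); apply/idP/eqP => [h|->].
  exact: mem_porbits h vD.
by apply/porbitsP; exists v.
Qed.

Lemma card_porbit_cases s v :
  [\/ #|porbit s v| = 1%N, #|porbit s v| = 2%N | (2 < #|porbit s v|)%N].
Proof.
have := card_porbit_neq0 s v.
case: #|porbit s v| => [//|[|[|n]]] _; first by apply: Or31.
  by apply: Or32.
by apply: Or33.
Qed.

(** On an orbit of size 1 or 2 the set of vertices determines the permutation; on a longer one the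
    arcs do, which keep the direction of travel. *)
Lemma perm_config_inj : injective perm_config.
Proof.
move=> s t E; apply/permP => v; case: (card_porbit_cases s v) => h.
- have vt : v \in isolated (perm_config t) by rewrite -E inE -card_porbit1 h.
  have sv : s v = v by apply/eqP; rewrite -card_porbit1 h.
  by rewrite sv; move: vt; rewrite inE => /eqP ->.
- have := @doubled_perm_config s _ _ (porbit_id s v).
  rewrite eqxx h E (doubled_perm_config _ (porbit_id s v)) /= h eqxx andbT => /eqP Est.
  move: (h); rewrite [in #|_|]Est => /eqP; rewrite card_porbit2 => /andP[tv _].
  have : s v \in porbit t v by rewrite -Est mem_porbitf porbit_id.
  move/eqP: (h); rewrite card_porbit2 => /andP[sv _].
  move/eqP: (h); rewrite {}Est card_porbit2 => /andP[_ /eqP ttv].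
  by rewrite porbit2 // !inE (negbTE sv) /= => /eqP.
- have : perm_arcs s (porbit s v) \in loops (perm_config s).
    by apply/loops_perm_configP; exists v.
  rewrite E => /loops_perm_configP[w Ew _].
  have : (v, s v) \in perm_arcs s (porbit s v).
    by rewrite mem_perm_arcs porbit_id eqxx.
  by rewrite Ew mem_perm_arcs => /andP[_ /eqP].
Qed.

Definition perm_along s := [forall v, (s v == v) || e v (s v)].

Lemma e_irrefl v : e v v = false.
Proof. by apply/negP => /e_bipartite; rewrite eqxx. Qed.

Lemma perm_along_edge s v : perm_along s -> s v != v -> e v (s v).
Proof. by move=> /forallP/(_ v); case: eqP. Qed.

(** Each step along the orbit follows an edge and flips the colour, and one full turn restores
    it. *)
Lemma porbit_even s v : perm_along s -> (1 < #|porbit s v|)%N -> ~~ odd #|porbit s v|.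
Proof.
move=> hs h.
have nf w : w \in porbit s v -> s w != w.
  rewrite -eq_porbit_mem => /eqP E; rewrite -card_porbit1 E.
  by rewrite neq_ltn h orbT.
have iterE k : iter k s v \in porbit s v.
  by rewrite -permX mem_porbit.
have col k : colour (iter k s v) = odd k (+) colour v.
  elim: k => [//|k IH]; rewrite iterS.
  have := e_bipartite (perm_along_edge hs (nf _ (iterE k))).
  by rewrite IH /=; case: (odd k); case: (colour v); case: (colour _).
have := col #|porbit s v|; rewrite iter_porbit.
by case: odd => //; case: (colour v).
Qed.

Lemma perm_config_configuration s : perm_along s -> lv_configuration e (perm_config s).
Proof.
move=> hs; split.
- move=> A /loops_perm_configP[v -> h].
  have cyc := cycle_orbit (@perm_inj _ s) v.
  have vin : v \in fingraph.orbit s v by rewrite -fconnect_orbit connect0.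
  have porb := porbit_fcycle cyc vin.
  have uni := orbit_uniq s v.
  have sz : #|porbit s v| = size (fingraph.orbit s v).
    by rewrite (eq_card porb); apply/card_uniqP.
  exists (fingraph.orbit s v); split.
  + apply/andP; split=> //.
    apply: sub_in_cycle cyc; last by apply/allP => w; exact: id.
    move=> w z win _ /eqP <-; apply: perm_along_edge => //.
    rewrite -card_porbit1; have := porb w; rewrite win -eq_porbit_mem => /eqP ->.
    by rewrite neq_ltn (ltnW h) orbT.
  + by rewrite -sz porbit_even // ltnW.
  + rewrite -sz; have := @porbit_even s v hs (ltnW h).
    by move: h; case: #|_| => [|[|[|[|n]]]].
  + apply: arcs_perm porb => w win.
    by have /eqP := next_cycle cyc win.
- move=> D; rewrite inE => /andP[/porbitsP[v ->] h].
  move: (h); rewrite card_porbit2 => /andP[sv /eqP ssv].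
  by exists v, (s v); split; [exact: perm_along_edge|exact: porbit2].
- move=> v.
  (* The size of the orbit of [v] decides which of the three counts at [v] is 1; the other two
     vanish. *)
  have -> : [set D in doubled (perm_config s) | v \in D] =
      if #|porbit s v| == 2%N then [set porbit s v] else set0.
    apply/setP => D; rewrite inE; case vD: (v \in D).
      rewrite (doubled_perm_config s vD) andbT; case: eqVneq => [->|ne] /=.
        by case: eqP; rewrite ?inE ?eqxx.
      by case: ifP; rewrite !inE ?(negbTE ne).
    rewrite andbF; case: ifP; rewrite !inE // => _.
    by apply/esym/negP => /eqP DE; rewrite DE porbit_id in vD.
  have -> : [set A in loops (perm_config s) | v \in loop_support A] =
      if (2 < #|porbit s v|)%N then [set perm_arcs s (porbit s v)] else set0.
    apply/setP => A; rewrite inE; apply/andP/idP => [[]|].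
      move=> /loops_perm_configP[w -> h]; rewrite loop_support_perm_arcs.
      by rewrite -eq_porbit_mem => /eqP ->; rewrite h inE.
    case: ifP; rewrite ?inE // => h /eqP ->.
    rewrite loop_support_perm_arcs porbit_id; split=> //.
    by apply/loops_perm_configP; exists v.
  rewrite [isolated _]/= inE -card_porbit1.
  by case: (card_porbit_cases s v) => h; rewrite ?h ?cards0 ?cards1 //;
    move: h; case: #|_| => [|[|[|n]]] // _; rewrite ?cards0 ?cards1.
Qed.

Section PermOfConfig.
Variable C : lv_collection V.
Hypothesis confC : lv_configuration e C.

(* [step v w] says that the permutation encoded by [C] maps [v] to [w]. *)
Let step v w : Prop :=
  [\/ exists2 A, A \in loops C & (v, w) \in A,
      exists2 D, D \in doubled C & [/\ v \in D, w \in D & v != w]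
    | v \in isolated C /\ w = v].

Let support_arc (A : {set V * V}) v w : (v, w) \in A -> v \in loop_support A.
Proof. by move=> h; apply/imsetP; exists (v, w). Qed.

(** The counts at [v] sum to 1, so a single object of [C] covers [v], and that object determines the
    successor of [v]. *)
Let step_fun v w w' : step v w -> step v w' -> w = w'.
Proof.
have [loopsC edgesC /(_ v)] := confC.
set L := [set A in _ | _]; set D := [set D in _ | _] => count.
have L1 A A' : A \in L -> A' \in L -> A = A' /\ (D = set0 /\ v \notin isolated C).
  move=> h h'; have : (0 < #|L|)%N by apply/card_gt0P; exists A.
  case EL : #|L| count => [|[|n]] // count _.
  split; first by have /card_le1_eqP U : (#|L| <= 1)%N by [rewrite EL]; apply: U.
  by split; [apply/eqP; rewrite -cards_eq0|case: (_ \in _) count]; lia.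
have D1 B B' : B \in D -> B' \in D -> B = B' /\ v \notin isolated C.
  move=> h h'; have : (0 < #|D|)%N by apply/card_gt0P; exists B.
  case ED : #|D| count => [|[|n]] count //; last by lia.
  split; first by have /card_le1_eqP U : (#|D| <= 1)%N by [rewrite ED]; apply: U.
  by case: (_ \in _) count => //; lia.
have inL A u : A \in loops C -> (v, u) \in A -> A \in L.
  by move=> h /support_arc hv; rewrite inE h.
have inD B : B \in doubled C -> v \in B -> B \in D by move=> h hv; rewrite inE h.
case=> [[A hA Aw]|[B hB [vB wB vw]]|[iv ->]] [[A' hA' Aw']|[B' hB' [vB' wB' vw']]|[iv' ->]] //.
- have [EA _] := L1 _ _ (inL _ _ hA Aw) (inL _ _ hA' Aw').
  have [c [_ _ _ Ec]] := loopsC _ hA.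
  by move: Aw Aw'; rewrite -EA Ec !mem_arcs => /andP[_ /eqP ->] /andP[_ /eqP ->].
- have [_ [D0 _]] := L1 _ _ (inL _ _ hA Aw) (inL _ _ hA Aw).
  by have := inD _ hB' vB'; rewrite D0 inE.
- have [_ [_]] := L1 _ _ (inL _ _ hA Aw) (inL _ _ hA Aw).
  by rewrite iv'.
- have [_ [D0 _]] := L1 _ _ (inL _ _ hA' Aw') (inL _ _ hA' Aw').
  by have := inD _ hB vB; rewrite D0 inE.
- have [EB _] := D1 _ _ (inD _ hB vB) (inD _ hB' vB').
  have [p [q [_ EBpq]]] := edgesC _ hB.
  move: vB wB vw wB' vw'; rewrite -EB EBpq !inE.
  by case/orP=> /eqP -> /orP[]/eqP ->; rewrite ?eqxx // => _ /orP[]/eqP ->; rewrite ?eqxx.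
- have [_] := D1 _ _ (inD _ hB vB) (inD _ hB vB).
  by rewrite iv'.
- have [_ [_]] := L1 _ _ (inL _ _ hA' Aw') (inL _ _ hA' Aw').
  by rewrite iv.
- have [_] := D1 _ _ (inD _ hB' vB') (inD _ hB' vB').
  by rewrite iv.
Qed.

Let doubled_step D u v : D = [set u; v] -> D \in doubled C -> e u v -> step u v.
Proof.
move=> ED DC euv; apply: Or32; exists D; rewrite // ED !inE !eqxx orbT; split=> //.
by apply/negP => /eqP E; rewrite E e_irrefl in euv.
Qed.

(** Some object covers [w]; the predecessor is the previous vertex of a loop, the other end of a
    doubled edge, or [w] itself. *)
Let step_onto w : exists v, step v w.
Proof.
have [loopsC edgesC /(_ w) count] := confC.
case EL : #|_| count => [|n].
  rewrite add0n; case ED : #|_| => [|n'] count.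
    by exists w; apply: Or33; split=> //; case: (_ \in _) count.
  have : (0 < #|[set D in doubled C | w \in D]|)%N by rewrite ED.
  case/card_gt0P => D; rewrite inE => /andP[DC wD].
  have [p [q [epq EDpq]]] := edgesC _ DC; have eqp : e q p by rewrite e_sym.
  have [-> | ->] : w = p \/ w = q by move: wD; rewrite EDpq !inE => /orP[]/eqP; auto.
    by exists q; apply: doubled_step DC eqp; rewrite setUC.
  by exists p; apply: doubled_step DC epq.
move=> _; have : (0 < #|[set A in loops C | w \in loop_support A]|)%N by rewrite EL.
case/card_gt0P => A; rewrite inE => /andP[AC].
have [c [/andP[_ uc] _ _ Ec]] := loopsC _ AC; rewrite Ec mem_loop_support => wc.
exists (prev c w); apply: Or31; exists A => //.
by rewrite Ec mem_arcs mem_prev wc next_prev ?eqxx.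
Qed.

Lemma perm_config_onto : exists2 s, perm_along s & perm_config s = C.
Proof.
have [loopsC edgesC count] := confC.
(* [h] chooses a predecessor of each vertex. It is injective because successors are unique, hence
   bijective, and the permutation sought is its inverse. *)
have [h hstep] := fin_all_exists step_onto.
have h_inj : injective h.
  by move=> w w' E; apply: step_fun (hstep w) _; rewrite E.
pose s := (perm h_inj)^-1%g.
have sstep v : step v (s v).
  by have := hstep (s v); rewrite -[h (s v)](permE h_inj) permKV.
have nextE A c v : A \in loops C -> A = arcs c -> v \in c -> s v = next c v.
  move=> AC EA vc; apply: step_fun (sstep v) _; apply: Or31; exists A => //.
  by rewrite EA mem_arcs vc eqxx.
have loopE A c v : A \in loops C -> A = arcs c -> ucycle e c -> v \in c ->
    porbit s v =i c /\ A = perm_arcs s (porbit s v).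
  move=> AC EA /andP[_ uc] vc.
  have sc : fcycle s c.
    have := cycle_next uc; apply: sub_in_cycle; last by apply/allP => w; exact: id.
    by move=> w z wc _ /eqP <-; apply/eqP; apply: nextE AC EA wc.
  have porb := porbit_fcycle sc vc; split=> //.
  rewrite EA; apply/esym/arcs_perm => // w wc; exact: nextE AC EA wc.
have doubE D v : D \in doubled C -> v \in D ->
    [/\ D = porbit s v, s v != v, s (s v) = v & e v (s v)].
  move=> DC vD; have [p [q [epq ED]]] := edgesC _ DC.
  have eqp : e q p by rewrite e_sym.
  have sp : s p = q by apply: step_fun (sstep p) _; apply: doubled_step DC epq.
  have sq : s q = p.
    by apply: step_fun (sstep q) _; apply: doubled_step DC eqp; rewrite setUC.
  have pq : p != q by apply/negP => /eqP E; rewrite E e_irrefl in epq.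
  have E2 : D = porbit s p by rewrite porbit2 sp // eq_sym.
  move: vD; rewrite {1}ED !inE => /orP[]/eqP ->; first by rewrite sp sq eq_sym.
  by rewrite sq sp; split=> //; rewrite E2 -sp porbitf.
have arcE A v w : A \in loops C -> (v, w) \in A ->
    exists c, [/\ ucycle e c, (4 <= size c)%N, v \in c & A = arcs c].
  move=> AC vw; have [c [uc _ sz Ec]] := loopsC _ AC; exists c; split=> //.
  by rewrite -mem_loop_support -Ec (support_arc vw).
have loop_edge A v w : A \in loops C -> (v, w) \in A -> e v (s v).
  move=> AC vw; have [c [uc _ vc Ec]] := arcE _ _ _ AC vw.
  by rewrite (nextE _ _ _ AC Ec vc); case/andP: uc => /next_cycle -> .
have sz_c c v : ucycle e c -> porbit s v =i c -> #|porbit s v| = size c.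
  by case/andP => _ uc E; rewrite (eq_card E); apply/card_uniqP.
exists s.
  apply/forallP => v; case: (sstep v) => [[A AC vw]|[D DC [vD _ _]]|[_ ->]].
  - by rewrite (loop_edge _ _ _ AC vw) orbT.
  - by have [_ _ _ ->] := doubE _ _ DC vD; rewrite orbT.
  - by rewrite eqxx.
case EC : C => [[L D] I]; congr (_, _, _).
- have -> : L = loops C by rewrite EC.
  apply/setP => A; apply/(loops_perm_configP s A)/idP => [[v -> hv]|AC].
    case: (sstep v) => [[B BC vw]|[B BC [vB _ _]]|[_ sv]].
    + have [c [uc sz vc Ec]] := arcE _ _ _ BC vw.
      by have [_ <-] := loopE _ _ _ BC Ec uc vc.
    + have [_ sv ssv _] := doubE _ _ BC vB.
      by move: hv; have := card_porbit2 s v; rewrite sv ssv eqxx => /eqP ->.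
    + by move: hv; have := card_porbit1 s v; rewrite sv eqxx => /eqP ->.
  have [c [uc _ sz Ec]] := loopsC _ AC.
  case: c uc sz Ec => [//|v c] uc sz Ec; exists v.
    by have [_] := loopE _ _ _ AC Ec uc (mem_head _ _).
  have [porb _] := loopE _ _ _ AC Ec uc (mem_head _ _).
  by rewrite (sz_c _ _ uc porb) ltnW.
- have -> : D = doubled C by rewrite EC.
  apply/setP => B; rewrite inE; apply/andP/idP => [[/porbitsP[v ->] hv]|BC].
    case: (sstep v) => [[A AC vw]|[A AC [vA _ _]]|[_ sv]].
    + have [c [uc sz vc Ec]] := arcE _ _ _ AC vw.
      have [porb _] := loopE _ _ _ AC Ec uc vc.
      by move: hv sz; rewrite (sz_c _ _ uc porb) => /eqP ->.
    + by have [<-] := doubE _ _ AC vA.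
    + by move: hv; rewrite card_porbit2 sv eqxx.
  have [p [q [epq EB]]] := edgesC _ BC.
  have [|EBp sp ssp _] := doubE B p BC; first by rewrite EB !inE eqxx.
  split; first by rewrite EBp; apply/porbitsP; exists p.
  by rewrite EBp card_porbit2 sp ssp eqxx.
- have -> : I = isolated C by rewrite EC.
  apply/setP => v; rewrite inE.
  have notiso w : step v w -> w != v -> v \notin isolated C.
    move=> st; apply: contraNN => vI; apply/eqP; apply: step_fun st _.
    by apply: Or33.
  case: (sstep v) => [[A AC vw]|[A AC [vA _ _]]|[-> ->]]; last by rewrite eqxx.
  + have sv : s v != v.
      apply/negP => /eqP E; have := loop_edge _ _ _ AC vw.
      by rewrite E e_irrefl.
    by rewrite (negbTE (notiso _ (sstep v) sv)) (negbTE sv).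
  + have [_ sv _ _] := doubE _ _ AC vA.
    by rewrite (negbTE (notiso _ (sstep v) sv)) (negbTE sv).
Qed.

End PermOfConfig.

Definition lv_matrix u v : R :=
  if u == v then x v else if e u v then sgn R o u v * a u v else 0.

Lemma doubled_weight_set2 u v : u != v ->
  doubled_weight a [set u; v] = a u v * a v u.
Proof.
move=> uv; rewrite /doubled_weight (eq_bigl (mem [set (u, v); (v, u)])).
  rewrite big_setU1 ?big_set1 //= inE; apply/negP => /eqP[E _].
  by rewrite E eqxx in uv.
move=> [w z]; rewrite !inE /= !xpair_eqE.
have [->|wu] /= := eqVneq w u.
  rewrite (negbTE uv) /= orbF; have [->|zv] := eqVneq z v; first by rewrite orbT.
  by rewrite orbF; case: (eqVneq z u).
have [->|//] := eqVneq w v; have [->|zu] := eqVneq z u.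
  by rewrite /= (eq_sym v u) uv ?orbT.
by case: (eqVneq z v).
Qed.

(** The comparison is made orbit by orbit with the sign of [odd_permE]. An even loop has sign -1,
    the minus sign of its weight; on a doubled edge the sign -1 cancels the product of the two
    opposite values of [sgn]; a fixed point has sign 1. *)
Lemma lv_weight_perm_config s : perm_along s ->
  lv_weight o x a (perm_config s) = (-1) ^+ s * \prod_v lv_matrix v (s v).
Proof.
move=> hs; rewrite odd_permE (partition_porbits _ s) -big_split /=.
have entry v : s v != v -> lv_matrix v (s v) = sgn R o v (s v) * a v (s v).
  by move=> sv; rewrite /lv_matrix eq_sym (negbTE sv) (perm_along_edge hs sv).
pose W (O : {set V}) := (-1) ^+ #|O|.+1 * \prod_(v in O) lv_matrix v (s v).
rewrite -[RHS]/(\prod_(O in porbits s) W O).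
(* The orbits are split by size, above 2, equal to 2 and equal to 1, to match the three factors of
   [lv_weight]. *)
rewrite (bigID (fun O : {set V} => (2 < #|O|)%N)) /=.
rewrite (bigID (fun O : {set V} => #|O| == 2%N) (fun O => (O \in porbits s) && ~~ _)) /=.
rewrite /lv_weight -mulrA; congr (_ * (_ * _)).
- rewrite /loops /= big_imset => [|O O' _ _ E]; last first.
    by rewrite -(loop_support_perm_arcs s O) E loop_support_perm_arcs.
  apply: eq_big => [O|O]; first by rewrite inE.
  rewrite inE => /andP[/porbitsP[v ->] h]; rewrite /loop_weight /W.
  rewrite -signr_odd /= porbit_even ?(ltnW h) // mulN1r; congr (- _).
  rewrite big_imset => [|u w _ _ [] //]; apply: eq_bigr => u uv /=.
  rewrite entry // -card_porbit1; move: uv; rewrite -eq_porbit_mem => /eqP ->.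
  by rewrite neq_ltn (ltnW h) orbT.
- apply: eq_big => [O|O]; rewrite inE.
    by case: (_ \in _) => //=; case: eqP => [->|]; rewrite ?andbF.
  move=> /andP[/porbitsP[v ->]]; rewrite card_porbit2 => /andP[sv /eqP ssv].
  have vs : v != s v by rewrite eq_sym.
  have prod2 (F : V -> R) : \prod_(u in porbit s v) F u = F v * F (s v).
    by rewrite porbit2 // big_setU1 ?inE ?big_set1.
  rewrite /W prod2 !entry ?ssv // porbit2 // cards2 vs.
  rewrite doubled_weight_set2 //.
  have evs := perm_along_edge hs sv.
  have [_ /(_ _ _ evs)] := o_orient; rewrite /sgn.
  by case: (o v _); case: (o _ v) => //= _; ring.
- have fix_porbit v : v \in isolated (perm_config s) -> porbit s v = [set v].
    rewrite inE -card_porbit1 => /cards1P[w E].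
    by have := porbit_id s v; rewrite E inE => /eqP ->.
  rewrite (eq_bigl (mem [set porbit s v | v in isolated (perm_config s)])) => [|O].
    rewrite big_imset => [|v w /fix_porbit Ev /fix_porbit Ew /setP/(_ v)] /=; last first.
      by rewrite Ev Ew !inE eqxx => /esym/eqP.
    apply: eq_bigr => v vI; rewrite /W fix_porbit // cards1 big_set1 sqrrN expr1n mul1r.
    by move: vI; rewrite inE => /eqP sv; rewrite /lv_matrix sv eqxx.
  apply/idP/imsetP => [/andP[/andP[/porbitsP[v ->]]]|[v]].
    have := card_porbit1 s v; case: (card_porbit_cases s v) => h; rewrite ?h // => sv _ _.
    by exists v; rewrite // inE -sv.
  rewrite inE -card_porbit1 => /eqP h ->; rewrite h !andbT /=.
  by apply/porbitsP; exists v.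
Qed.

(** A permutation sending some vertex to a different vertex that is not a neighbour contributes 0;
    [perm_config] matches the others bijectively with the configurations. *)
Theorem lv_partition_function_perm :
  lv_partition_function e o x a =
  \sum_(s : {perm V}) (-1) ^+ s * \prod_v lv_matrix v (s v).
Proof.
rewrite [RHS](bigID perm_along) /= [X in _ = _ + X]big1 => [|s] ; last first.
  case/forallPn => v; rewrite negb_or => /andP[sv esv].
  by rewrite (bigD1 v) //= /lv_matrix eq_sym (negbTE sv) (negbTE esv) mul0r mulr0.
rewrite addr0 -(eq_bigr _ lv_weight_perm_config).
rewrite -(big_imset (lv_weight o x a) (A := perm_along)) => [|s t _ _]; last first.
  exact: perm_config_inj.
apply: eq_bigl => C; apply/asboolP/imsetP => [/perm_config_onto[s hs <-]|[s hs ->]].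
  by exists s.
exact: perm_config_configuration.
Qed.

End ModelAsDeterminant.

(** * Spectrum of the Klein grid matrix *)

Section OneDimension.
Variables (F : fieldType) (n : nat).
Implicit Types (X : 'M[F]_n) (eta : F) (w : 'I_n -> F).

(* As 0^-1 = 0, [eta = 0] gives the open path. *)
Definition twisted_path eta : 'M[F]_n :=
  \matrix_(i, j) ((j == i.+1 :> nat)%:R - (i == j.+1 :> nat)%:R
                  + (i.+1 == n)%:R * (j == 0 :> nat)%:R * eta
                  - (i == 0 :> nat)%:R * (j.+1 == n)%:R * eta^-1).

Definition corner_mx : 'M[F]_n :=
  \matrix_(i, j) ((i.+1 == n)%:R * (j == 0 :> nat)%:R
                  + (i == 0 :> nat)%:R * (j.+1 == n)%:R).

Definition alt_mx : 'M[F]_n := \matrix_(i, j) ((i == j)%:R * (-1) ^+ i).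

Definition rev_mx : 'M[F]_n := \matrix_(i, j) (j == rev_ord i)%:R.

Lemma sum_delta_nat (k : nat) (g : nat -> F) :
  \sum_(j < n) (j == k :> nat)%:R * g j = (k < n)%:R * g k.
Proof.
case: ltnP => kn.
  rewrite (bigD1 (Ordinal kn)) //= eqxx big1 ?addr0 // => j jk.
  by have /negbTE -> : j != k :> nat; [apply: contraNneq jk => E; apply/eqP/val_inj|rewrite mul0r].
by rewrite mul0r big1 // => j _; rewrite ltn_eqF ?mul0r // (leq_trans (ltn_ord j)).
Qed.

(** Since the inverse of [iota] is [- iota], both corner entries of the twisted path equal
    [iota]. *)
Lemma twisted_path_corner iota : iota ^+ 2 = -1 ->
  twisted_path iota = twisted_path 0 + iota *: corner_mx.
Proof.
move=> i2; have i0 : iota != 0.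
  by apply: contra_eq_neq i2 => ->; rewrite expr0n eq_sym oppr_eq0 oner_eq0.
have iV : iota^-1 = - iota.
  by apply: (mulfI i0); rewrite mulfV // mulrN -expr2 i2 opprK.
by apply/matrixP => i j; rewrite !mxE iV invr0; ring.
Qed.

(** Column [k] of the Vandermonde matrix is the geometric sequence of ratio [w k]. Shifting it by
    [n] multiplies it by [eta], which is exactly what the corner entries encode, so the matrix acts
    as a forward shift minus a backward shift. *)
Lemma twisted_path_eigen eta w : (0 < n)%N -> eta != 0 -> (forall k, w k ^+ n = eta) ->
  twisted_path eta *m Vandermonde n (\row_k w k) =
  Vandermonde n (\row_k w k) *m diag_mx (\row_k (w k - (w k)^-1)).
Proof.
move=> n0 eta0 wn; apply/matrixP => i k; rewrite mul_mx_diag !mxE.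
have w0 : w k != 0 by apply: contraNneq eta0 => E; rewrite -(wn k) E expr0n gtn_eqF.
transitivity (\sum_(j < n) (j == i.+1 :> nat)%:R * w k ^+ j
   - \sum_(j < n) (i == j.+1 :> nat)%:R * w k ^+ j
   + (i.+1 == n)%:R * eta * (\sum_(j < n) (j == 0 :> nat)%:R * w k ^+ j)
   - (i == 0 :> nat)%:R * eta^-1 * (\sum_(j < n) (j == n.-1 :> nat)%:R * w k ^+ j)).
  rewrite !mulr_sumr -!sumrB -big_split -sumrB /=; apply: eq_bigr => j _.
  rewrite !mxE; have -> : (j.+1 == n) = (j == n.-1 :> nat) by lia.
  ring.
rewrite !sum_delta_nat.
have -> : (n.-1 < n)%N by lia.
rewrite n0 !mul1r expr0 mulr1.
(* Row 0 has no backward neighbour inside the path; as [i.-1] truncates to 0 there, the factor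
   [(0 < i)%:R] removes that term. *)
have -> : \sum_(j < n) (i == j.+1 :> nat)%:R * w k ^+ j =
          (0 < i)%:R * w k ^+ i * (w k)^-1.
  rewrite (eq_bigr (fun j : 'I_n => (0 < i)%:R * ((j == i.-1 :> nat)%:R * w k ^+ j))).
    rewrite -mulr_sumr sum_delta_nat (leq_ltn_trans (leq_pred _) (ltn_ord i)) mul1r.
    case: (nat_of_ord i) => [|i']; first by rewrite !mul0r.
    by rewrite !mul1r exprSr mulfK.
  move=> j _; rewrite mulrA; congr (_ * _); rewrite -natrM mulnb; congr (_%:R).
  by case: (nat_of_ord i) => [|i'] //=; rewrite eqSS eq_sym.
have En : eta = w k ^+ n.-1 * w k by rewrite -exprSr prednK ?wn.
have -> : (i == 0 :> nat)%:R * eta^-1 * w k ^+ n.-1 = (i == 0 :> nat)%:R * (w k)^-1.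
  by rewrite -mulrA En invfM mulrAC mulVf ?mul1r // expf_neq0.
rewrite [X in X - _]addrAC.
have -> : (i.+1 < n)%:R * w k ^+ i.+1 + (i.+1 == n)%:R * eta
   = w k ^+ i * w k.
  have -> : (i.+1 < n)%N = (i.+1 != n) by have := ltn_ord i; lia.
  case: eqVneq => [E|_] /=; last by rewrite mul1r mul0r addr0 exprSr.
  by rewrite mul0r mul1r add0r -(wn k) -[in LHS]E exprSr.
have -> : w k ^+ i * (w k - (w k)^-1) =
   w k ^+ i * w k - ((0 < i)%:R * w k ^+ i * (w k)^-1 + (i == 0 :> nat)%:R * (w k)^-1).
  by case: (nat_of_ord i) => [|i'] /=; rewrite ?expr0; ring.
ring.
Qed.

Lemma Vandermonde_unit w : injective w -> Vandermonde n (\row_k w k) \in unitmx.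
Proof.
move=> w_inj; rewrite unitmxE unitfE det_Vandermonde.
apply/prodf_neq0 => i _; apply/prodf_neq0 => j ij.
by rewrite !mxE subr_eq0 (inj_eq w_inj) -val_eqE gtn_eqF.
Qed.

Lemma mul_alt_mx X i j : (alt_mx *m X) i j = (-1) ^+ i * X i j.
Proof.
rewrite mxE (bigD1 i) //= !mxE eqxx mul1r big1 ?addr0 // => k /negbTE ki.
by rewrite !mxE eq_sym ki !mul0r.
Qed.

Lemma mulmx_alt X i j : (X *m alt_mx) i j = X i j * (-1) ^+ j.
Proof.
rewrite mxE (bigD1 j) //= !mxE eqxx mul1r big1 ?addr0 // => k /negbTE kj.
by rewrite !mxE kj mul0r mulr0.
Qed.

Lemma mul_rev_mx X i j : (rev_mx *m X) i j = X (rev_ord i) j.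
Proof.
rewrite mxE (bigD1 (rev_ord i)) //= !mxE eqxx mul1r big1 ?addr0 // => k /negbTE ki.
by rewrite !mxE ki mul0r.
Qed.

Lemma mulmx_rev X i j : (X *m rev_mx) i j = X i (rev_ord j).
Proof.
rewrite mxE (bigD1 (rev_ord j)) //= !mxE rev_ordK eqxx mulr1 big1 ?addr0 // => k /negbTE ki.
by rewrite !mxE -[j in j == _]rev_ordK (inj_eq rev_ord_inj) eq_sym ki mulr0.
Qed.

Lemma alt_mxK : alt_mx *m alt_mx = 1%:M.
Proof.
apply/matrixP => i j; rewrite mul_alt_mx !mxE mulrCA -expr2 sqrr_sign mulr1.
by case: eqVneq.
Qed.

Lemma rev_mxK : rev_mx *m rev_mx = 1%:M.
Proof. by apply/matrixP => i j; rewrite mul_rev_mx !mxE rev_ordK eq_sym. Qed.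

(** The hypothesis covers both the open path, as the inverse of 0 is 0, and the antiperiodic
    cycle. *)
Lemma trmx_twisted_path eta : eta^-1 = eta -> (twisted_path eta)^T = - twisted_path eta.
Proof. by move=> h; apply/matrixP => i j; rewrite !mxE h; ring. Qed.

Lemma trmx_corner : corner_mx^T = corner_mx.
Proof. by apply/matrixP => i j; rewrite !mxE; ring. Qed.

Lemma trmx_alt : alt_mx^T = alt_mx.
Proof. by apply/matrixP => i j; rewrite !mxE eq_sym; case: eqVneq => [->|]; rewrite ?mul0r. Qed.

Lemma trmx_rev : rev_mx^T = rev_mx.
Proof.
apply/matrixP => i j; rewrite !mxE.
by rewrite -{1}(rev_ordK i) (inj_eq rev_ord_inj) eq_sym.
Qed.

Hypothesis n_even : ~~ odd n.

Lemma alt_mx_rev : alt_mx *m rev_mx = - (rev_mx *m alt_mx).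
Proof.
apply/matrixP => i j; rewrite mul_alt_mx [RHS]mxE mulmx_alt !mxE.
case: eqP => [->|_]; last by rewrite mulr0 mul0r oppr0.
rewrite mulr1 mul1r -signr_odd -[in RHS]signr_odd /=.
have -> : odd (n - i.+1) = ~~ odd i by have := ltn_ord i; lia.
by case: (odd i); rewrite ?opprK.
Qed.

(** Nonzero entries join indices of opposite parity, the corners included because [n] is even. *)
Lemma alt_mx_twisted_path eta :
  alt_mx *m twisted_path eta = - (twisted_path eta *m alt_mx).
Proof.
apply/matrixP => i j; rewrite mul_alt_mx [RHS]mxE mulmx_alt !mxE.
have [ij|ij] := eqVneq (odd i) (odd j).
  have -> : (j == i.+1 :> nat) = false by lia.
  have -> : (i == j.+1 :> nat) = false by lia.
  have -> : (i.+1 == n)%:R * (j == 0 :> nat)%:R = 0 :> F.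
    by rewrite -natrM mulnb; have -> : (i.+1 == n) && (j == 0 :> nat) = false by lia.
  have -> : (i == 0 :> nat)%:R * (j.+1 == n)%:R = 0 :> F.
    by rewrite -natrM mulnb; have -> : (i == 0 :> nat) && (j.+1 == n) = false by lia.
  ring.
rewrite -signr_odd -[X in _ = - (_ * X)]signr_odd.
have -> : odd i = ~~ odd j by lia.
by case: (odd j); ring.
Qed.

(** Reversal exchanges forward and backward steps and swaps the two corner entries, which for
    [eta = -1] are opposite. *)
Lemma rev_mx_antiperiodic :
  rev_mx *m twisted_path (-1) = - (twisted_path (-1) *m rev_mx).
Proof.
apply/matrixP => i j; rewrite mul_rev_mx [RHS]mxE mulmx_rev !mxE /=.
have hi := ltn_ord i; have hj := ltn_ord j.
have -> : ((j == (n - i.+1).+1 :> nat) = (i == (n - j.+1).+1 :> nat))%N by lia.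
have -> : ((n - i.+1 == j.+1 :> nat) = (n - j.+1 == i.+1 :> nat))%N by lia.
have -> : (((n - i.+1).+1 == n) = (i == 0 :> nat))%N by lia.
have -> : (((n - j.+1).+1 == n) = (j == 0 :> nat))%N by lia.
have -> : ((n - i.+1 == 0) = (i.+1 == n))%N by lia.
have -> : ((n - j.+1 == 0) = (j.+1 == n))%N by lia.
rewrite invrN1; ring.
Qed.

End OneDimension.

(** * Ring identities for anticommuting sums and for spectral projections *)

Section NonCommutative.
Variable A : pzRingType.
Implicit Types s t p b f g e d i : A.

Lemma sqr_anticommuting3 s t p :
    s * t = - (t * s) -> s * p = - (p * s) -> t * p = - (p * t) ->
  (s + t + p) * (s + t + p) = s * s + t * t + p * p.
Proof.
move=> st sp tp; rewrite !mulrDl !mulrDr st sp tp.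
by rewrite (AC (3*3*3) (1*5*9*(2*4)*(3*7)*(6*8))) /= !addNr !addr0.
Qed.

Lemma twisted_eigen t p b f e d i :
    GRing.comm b f -> GRing.comm i p -> GRing.comm d e ->
    b * e = i * e -> GRing.comm i f -> (t + i * p) * f = f * d ->
  (t + p * b) * (f * e) = f * e * d.
Proof.
move=> bf ip de be i_f tf.
rewrite mulrDl -(mulrA p b) (mulrA b f) bf -(mulrA f b) be (mulrA f i) -i_f.
by rewrite -(mulrA i f) (mulrA p i) -ip (mulrA t) (mulrA (i * p)) -!mulrDl tf -!mulrA de.
Qed.

(** The eigenvalues are [d] on the range of [e] and [- d] on that of [e'], so it is the square that
    acts by the single [d * d]. *)
Lemma sqr_twisted_eigen t p b f f' e e' d i :
    GRing.comm b f -> GRing.comm b f' -> GRing.comm i p ->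
    GRing.comm d e -> GRing.comm d e' -> GRing.comm i f -> GRing.comm i f' ->
    b * e = i * e -> b * e' = - i * e' ->
    (t + i * p) * f = f * d -> (t - i * p) * f' = - (f' * d) ->
  (t + p * b) * (t + p * b) * (f * e + f' * e') = (f * e + f' * e') * (d * d).
Proof.
move=> bf bf' ip de de' i_f i_f' be be' tf tf'.
have E : (t + p * b) * (f * e) = f * e * d by exact: twisted_eigen be i_f tf.
have E' : (t + p * b) * (f' * e') = - (f' * e' * d).
  rewrite -mulrN; apply: (@twisted_eigen _ _ _ _ _ _ (- i)) => //.
  - by apply/commr_sym/commrN/commr_sym.
  - by apply/commr_sym/commrN/commr_sym.
  - by apply/commr_sym/commrN/commr_sym.
  - by rewrite mulNr tf' mulrN.
rewrite -mulrA mulrDr E E' mulrBr (mulrA _ (f * e)) (mulrA _ (f' * e')) E E'.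
by rewrite mulNr opprK mulrDl !mulrA.
Qed.

(** With respect to the complementary idempotents [e] and [e'] both factors are block diagonal, and
    the blocks are inverted separately. *)
Lemma spectral_left_inverse g g' f f' e e' :
    g * f = 1 -> g' * f' = 1 -> GRing.comm e f -> GRing.comm e' f ->
    GRing.comm e f' -> GRing.comm e' f' ->
    e * e = e -> e' * e' = e' -> e * e' = 0 -> e' * e = 0 -> e + e' = 1 ->
  (g * e + g' * e') * (f * e + f' * e') = 1.
Proof.
move=> gf gf' ef e'f ef' e'f' ee ee' eo eo' e1.
have prod (a h : A) (c c' : A) : GRing.comm c h -> a * c * (h * c') = a * h * (c * c').
  by move=> ch; rewrite -mulrA (mulrA c) ch -mulrA mulrA.
rewrite mulrDl !mulrDr (prod _ _ _ _ ef) (prod _ _ _ _ ef') (prod _ _ _ _ e'f).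
by rewrite (prod _ _ _ _ e'f') ee ee' eo eo' !mulr0 addr0 add0r gf gf' !mul1r.
Qed.

End NonCommutative.

(** * Tensor products of three matrices *)

Section TripleTensor.
Variables (F : fieldType) (n1 n2 n3 : nat).
Implicit Types (X : 'M[F]_n1) (Y : 'M[F]_n2) (Z : 'M[F]_n3).

Definition tens3 X Y Z : 'M[F]_(n1 * n2 * n3) := X *t Y *t Z.

Definition idx3 (i : 'I_n1 * 'I_n2 * 'I_n3) : 'I_(n1 * n2 * n3) :=
  mxtens_index (mxtens_index i.1, i.2).

Definition unidx3 (k : 'I_(n1 * n2 * n3)) : 'I_n1 * 'I_n2 * 'I_n3 :=
  (mxtens_unindex (mxtens_unindex k).1, (mxtens_unindex k).2).

Lemma idx3K : cancel idx3 unidx3.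
Proof. by move=> [p r]; rewrite /idx3 /unidx3 !mxtens_indexK. Qed.

Lemma unidx3K : cancel unidx3 idx3.
Proof.
move=> k; case: (mxtens_indexP k) => i r; case: (mxtens_indexP i) => p q.
exact: (congr1 idx3 (idx3K (p, q, r))).
Qed.

Lemma tens3E X Y Z i j :
  tens3 X Y Z i j = X (unidx3 i).1.1 (unidx3 j).1.1 * Y (unidx3 i).1.2 (unidx3 j).1.2
                    * Z (unidx3 i).2 (unidx3 j).2.
Proof. by rewrite !mxE. Qed.

Lemma tens3_mul X Y Z X' Y' Z' :
  tens3 X Y Z *m tens3 X' Y' Z' = tens3 (X *m X') (Y *m Y') (Z *m Z').
Proof. by rewrite /tens3 !tensmx_mul. Qed.

Lemma tens3N1 X Y Z : tens3 (- X) Y Z = - tens3 X Y Z.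
Proof. by apply/matrixP => i j; rewrite [RHS]mxE !tens3E mxE; ring. Qed.

Lemma tens3N2 X Y Z : tens3 X (- Y) Z = - tens3 X Y Z.
Proof. by apply/matrixP => i j; rewrite [RHS]mxE !tens3E mxE; ring. Qed.

Lemma tens3N3 X Y Z : tens3 X Y (- Z) = - tens3 X Y Z.
Proof. by apply/matrixP => i j; rewrite [RHS]mxE !tens3E mxE; ring. Qed.

Lemma tens3D1 X X' Y Z : tens3 (X + X') Y Z = tens3 X Y Z + tens3 X' Y Z.
Proof. by apply/matrixP => i j; rewrite [RHS]mxE !tens3E mxE; ring. Qed.

Lemma tens3Z1 c X Y Z : tens3 (c *: X) Y Z = c *: tens3 X Y Z.
Proof. by apply/matrixP => i j; rewrite [RHS]mxE !tens3E mxE; ring. Qed.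

Lemma trmx_tens3 X Y Z : (tens3 X Y Z)^T = tens3 X^T Y^T Z^T.
Proof. by rewrite /tens3 !trmx_tens. Qed.

Definition tens3N := (tens3N1, tens3N2, tens3N3).

Lemma tens3_1 : tens3 1%:M 1%:M 1%:M = 1%:M.
Proof.
apply/matrixP => i j; rewrite tens3E !mxE -!natrM !mulnb.
by rewrite -(can_eq unidx3K); case: (unidx3 i) (unidx3 j) => [[p q] r] [[p' q'] r'].
Qed.

Lemma tens3_diag (u : 'rV[F]_n1) (v : 'rV[F]_n2) (w : 'rV[F]_n3) :
  tens3 (diag_mx u) (diag_mx v) (diag_mx w) =
  diag_mx (\row_k (u 0 (unidx3 k).1.1 * v 0 (unidx3 k).1.2 * w 0 (unidx3 k).2)).
Proof.
apply/matrixP => i j; rewrite tens3E [RHS]mxE [in RHS]mxE !mxE.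
rewrite !(mulrnAl, mulrnAr) -!mulrnA !mulnb -(can_eq unidx3K).
case: (unidx3 i) (unidx3 j) => [[p q] r] [[p' q'] r'].
by rewrite !xpair_eqE /=; do 3!case: (_ == _).
Qed.

End TripleTensor.

(** * The Klein grid matrix and its skew symmetry *)

Section KleinMatrixTranspose.
Variables (C : fieldType) (n1 n2 n3 : nat) (a1 a2 a3 : C).
Hypothesis n2_even : ~~ odd n2.

Definition klein_mx : 'M[C]_(n1 * n2 * n3) :=
  a1 *: (tens3 (@twisted_path C n1 0) (alt_mx C n2) (alt_mx C n3)
         + tens3 (corner_mx C n1) (alt_mx C n2 *m rev_mx C n2) (rev_mx C n3))
  + a2 *: tens3 1%:M (@twisted_path C n2 (-1)) (alt_mx C n3)
  + a3 *: tens3 1%:M 1%:M (@twisted_path C n3 (-1)).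

Lemma trmx_klein_mx : klein_mx^T = - klein_mx.
Proof.
rewrite /klein_mx !linearD !linearZ /= !trmx_tens3 !trmx1 trmx_mul.
rewrite !trmx_twisted_path ?invr0 ?invrN1 // !trmx_alt !trmx_rev trmx_corner.
have -> : rev_mx C n2 *m alt_mx C n2 = - (alt_mx C n2 *m rev_mx C n2).
  by rewrite alt_mx_rev // opprK.
by rewrite !tens3N !scalerN ?opprK.
Qed.

(** Transposition turns [x + K] into [x - K] without changing the determinant, and the product of
    the two is [x^2 - K^2]. *)
Lemma det_klein_mx_sqr x :
  (\det (x%:M + klein_mx)) ^+ 2 = \det ((x ^+ 2)%:M - klein_mx *m klein_mx).
Proof.
rewrite expr2 -{1}det_tr linearD /= tr_scalar_mx trmx_klein_mx -det_mulmx.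
by rewrite mulmxDr !mulmxBl -scalar_mxM -expr2 scalar_mxC addrA subrK.
Qed.

End KleinMatrixTranspose.

(** This carries the matrix with real weights to the complex field, where the required roots
    exist. *)
Lemma map_klein_mx (C C' : fieldType) (f : {rmorphism C -> C'})
    (n1 n2 n3 : nat) (a1 a2 a3 : C) :
  map_mx f (klein_mx n1 n2 n3 a1 a2 a3) = klein_mx n1 n2 n3 (f a1) (f a2) (f a3).
Proof.
have mapT n eta : map_mx f (twisted_path n eta) = twisted_path n (f eta).
  apply/matrixP => i j; rewrite !mxE.
  by rewrite !(rmorphB, rmorphD, rmorphN, rmorphM, rmorph_nat, fmorphV).
have mapc n : map_mx f (corner_mx C n) = corner_mx C' n.
  by apply/matrixP => i j; rewrite !mxE rmorphD !rmorphM !rmorph_nat.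
have maps n : map_mx f (alt_mx C n) = alt_mx C' n.
  by apply/matrixP => i j; rewrite !mxE rmorphM rmorphXn rmorphN1 rmorph_nat.
have mapr n : map_mx f (rev_mx C n) = rev_mx C' n.
  by apply/matrixP => i j; rewrite !mxE rmorph_nat.
rewrite /klein_mx /tens3 !map_mxD !map_mxZ map_mxD !map_mxT !map_mxM !map_mx1 !mapT.
by rewrite !maps !mapr !mapc rmorph0 rmorphN1.
Qed.

(** * Diagonalization of the square of the Klein grid matrix *)

Section KleinMatrix.
Variables (C : fieldType) (n1 n2 n3 : nat).
Hypotheses (n1_gt0 : (0 < n1)%N) (n2_gt0 : (0 < n2)%N) (n3_gt0 : (0 < n3)%N).
Hypotheses (n2_even : ~~ odd n2) (n3_even : ~~ odd n3).
Variables (iota : C) (w1 : 'I_n1 -> C) (w2 : 'I_n2 -> C) (w3 : 'I_n3 -> C).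
Hypotheses (iota2 : iota ^+ 2 = -1) (two_neq0 : 2 != 0 :> C).
Hypotheses (w1n : forall k, w1 k ^+ n1 = iota) (w1_inj : injective w1).
Hypotheses (w2n : forall k, w2 k ^+ n2 = -1) (w2_inj : injective w2).
Hypotheses (w3n : forall k, w3 k ^+ n3 = -1) (w3_inj : injective w3).
Variables (x a1 a2 a3 : C).

Local Notation klein_mx := (@klein_mx C n1 n2 n3 a1 a2 a3).

Local Notation T := (@twisted_path C n1 0).
Local Notation P := (corner_mx C n1).
Local Notation s2 := (alt_mx C n2).
Local Notation s3 := (alt_mx C n3).
Local Notation r2 := (rev_mx C n2).
Local Notation r3 := (rev_mx C n3).
Local Notation A2 := (@twisted_path C n2 (-1)).
Local Notation A3 := (@twisted_path C n3 (-1)).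
Local Notation V1 := (Vandermonde n1 (\row_k w1 k)).
Local Notation V1' := (Vandermonde n1 (\row_k (w1 k)^-1)).
Local Notation V2 := (Vandermonde n2 (\row_k w2 k)).
Local Notation V3 := (Vandermonde n3 (\row_k w3 k)).
Local Notation D1 := (diag_mx (\row_k (w1 k - (w1 k)^-1))).
Local Notation D2 := (diag_mx (\row_k (w2 k - (w2 k)^-1))).
Local Notation D3 := (diag_mx (\row_k (w3 k - (w3 k)^-1))).

(* [B] squares to -1; [e] and [e'] are the projections onto its eigenspaces
   for [iota] and [- iota]. *)
Let B : 'M[C]_(n1 * n2 * n3) := tens3 1%:M r2 (s3 *m r3).
Let e : 'M[C]_(n1 * n2 * n3) := 2^-1 *: (1%:M - iota *: B).
Let e' : 'M[C]_(n1 * n2 * n3) := 2^-1 *: (1%:M + iota *: B).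
Let i : 'M[C]_(n1 * n2 * n3) := iota%:M.

Let rs2 : r2 *m s2 = - (s2 *m r2). Proof. by rewrite alt_mx_rev // opprK. Qed.
Let rs3 : r3 *m s3 = - (s3 *m r3). Proof. by rewrite alt_mx_rev // opprK. Qed.

Let scaleI k l (X Y : 'M[C]_(n1 * n2 * n3)) : X *m Y = - (Y *m X) ->
  (k *: X) *m (l *: Y) = - ((l *: Y) *m (k *: X)).
Proof.
by move=> h; rewrite -!scalemxAr -!scalemxAl h !scalerN !scalerA mulrC.
Qed.

(* The first direction of [klein_mx] is [a1 *: (G *m S)], where [G] squares to 1
   and commutes with [S]. *)
Let S : 'M[C]_(n1 * n2 * n3) := tens3 T 1%:M 1%:M + tens3 P 1%:M 1%:M *m B.
Let G : 'M[C]_(n1 * n2 * n3) := tens3 1%:M s2 s3.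

Let GS : tens3 T s2 s3 + tens3 P (s2 *m r2) r3 = G *m S.
Proof.
by rewrite mulmxDr mulmxA !tens3_mul !mul1mx !mulmx1 !mulmxA alt_mxK mul1mx.
Qed.

Let SG : S *m G = G *m S.
Proof.
rewrite mulmxDl mulmxDr !mulmxA !tens3_mul !mul1mx !mulmx1 !mulmxA alt_mxK mul1mx.
(* Moving [G] past [B] crosses [s2] with [r2] and [s3] with [r3]; the two signs cancel. *)
by rewrite rs2 -mulmxA rs3 mulmxN mulmxA alt_mxK mul1mx !tens3N opprK.
Qed.

Lemma klein_mx_sqr :
  klein_mx *m klein_mx =
  a1 ^+ 2 *: (S *m S)
  + a2 ^+ 2 *: tens3 1%:M (A2 *m A2) 1%:M + a3 ^+ 2 *: tens3 1%:M 1%:M (A3 *m A3).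
Proof.
have sqrZ k (X : 'M[C]_(n1 * n2 * n3)) : (k *: X) *m (k *: X) = k ^+ 2 *: (X *m X).
  by rewrite -scalemxAl -scalemxAr scalerA -expr2.
have sA2 := alt_mx_twisted_path n2_even (-1 : C).
have sA3 := alt_mx_twisted_path n3_even (-1 : C).
have rA2 := rev_mx_antiperiodic C n2_even.
have rA3 := rev_mx_antiperiodic C n3_even.
rewrite [LHS]sqr_anticommuting3; last 1 first.
- apply: scaleI; rewrite !tens3_mul !mul1mx !mulmx1 sA3.
  by rewrite !tens3N.
(* The first square is [G S G S = G G S S], and [G G = 1]. *)
- rewrite ![in LHS]/GRing.mul /= !sqrZ !tens3_mul !mulmx1 alt_mxK GS.
  by rewrite -mulmxA (mulmxA S) SG -(mulmxA G) mulmxA tens3_mul !alt_mxK mulmx1 tens3_1 mul1mx.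
- apply: scaleI; rewrite mulmxDl mulmxDr opprD !tens3_mul !mul1mx !mulmx1.
  rewrite sA2 alt_mxK tens3N; congr (_ + _).
  (* In the corner term [A2] passes [r2] and [s2], and [s3] passes [r3]: three signs, hence
     anticommutation. *)
  by rewrite -mulmxA rA2 mulmxN (mulmxA s2) mulmxA sA2 rs3 !tens3N mulNmx !tens3N !opprK.
- apply: scaleI; rewrite mulmxDl mulmxDr opprD !tens3_mul !mul1mx !mulmx1.
  by rewrite sA3 rA3 !tens3N.
Qed.

(* [f] diagonalizes [S] on the range of [e], and [f'] on the range of [e'], with
   opposite eigenvalues: [V] diagonalizes the square of [S]. *)
Let f : 'M[C]_(n1 * n2 * n3) := tens3 V1 1%:M 1%:M.
Let f' : 'M[C]_(n1 * n2 * n3) := tens3 V1' 1%:M 1%:M.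
Let d : 'M[C]_(n1 * n2 * n3) := tens3 D1 1%:M 1%:M.
Let V : 'M[C]_(n1 * n2 * n3) := f *m e + f' *m e'.
Let U : 'M[C]_(n1 * n2 * n3) := tens3 1%:M V2 V3.

Let B2 : B *m B = - 1%:M.
Proof.
rewrite tens3_mul mulmx1 rev_mxK mulmxA -(mulmxA s3) rs3 mulmxN mulmxA alt_mxK mul1mx.
by rewrite mulNmx rev_mxK tens3N tens3_1.
Qed.

Let Be : B *m e = i *m e.
Proof.
rewrite /e /i mul_scalar_mx -scalemxAr [RHS]scalerA [iota * _]mulrC -scalerA; congr (_ *: _).
rewrite mulmxBr mulmx1 -scalemxAr B2 [RHS]scalerBr scalerA -expr2 iota2.
by rewrite scaleN1r scalerN !opprK addrC.
Qed.

Let Be' : B *m e' = - i *m e'.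
Proof.
rewrite /e' /i mulNmx mul_scalar_mx -scalemxAr scalerA [iota * _]mulrC -scalerA -scalerN.
congr (_ *: _).
rewrite mulmxDr mulmx1 -scalemxAr B2 scalerDr scalerA -expr2 iota2.
by rewrite scaleN1r scalerN opprB addrC.
Qed.

Let comm_e (X : 'M[C]_(n1 * n2 * n3)) : X *m B = B *m X ->
  X *m e = e *m X /\ X *m e' = e' *m X.
Proof.
move=> XB; rewrite /e /e' -!scalemxAr -!scalemxAl mulmxBr mulmxBl mulmxDr mulmxDl.
by rewrite -!scalemxAr -!scalemxAl XB mulmx1 mul1mx.
Qed.

Let comm_V (X : 'M[C]_(n1 * n2 * n3)) :
  X *m f = f *m X -> X *m f' = f' *m X -> X *m B = B *m X -> X *m V = V *m X.
Proof.
move=> Xf Xf' /comm_e[Xe Xe']; rewrite mulmxDr mulmxDl !mulmxA Xf Xf'.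
by rewrite -!mulmxA Xe Xe'.
Qed.

Let comm1 (X : 'M[C]_n1) (Y Y' : 'M[C]_n2) (Z Z' : 'M[C]_n3) :
  Y *m Y' = Y' *m Y -> Z *m Z' = Z' *m Z ->
  tens3 X Y Z *m tens3 1%:M Y' Z' = tens3 1%:M Y' Z' *m tens3 X Y Z.
Proof. by move=> h h'; rewrite !tens3_mul h h' mulmx1 mul1mx. Qed.

Let iota_neq0 : iota != 0.
Proof.
by apply: contra_eq_neq iota2 => ->; rewrite expr0n eq_sym oppr_eq0 oner_eq0.
Qed.

Let SSV : S *m S *m V = V *m (d *m d).
Proof.
have dB : d *m B = B *m d by apply: comm1; rewrite ?mul1mx ?mulmx1.
have [de de'] := comm_e dB.
apply: (@sqr_twisted_eigen _ _ _ _ _ _ _ _ _ i) => //.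
- by rewrite /GRing.comm /GRing.mul /= [RHS]comm1 // ?mul1mx ?mulmx1.
- by rewrite /GRing.comm /GRing.mul /= [RHS]comm1 // ?mul1mx ?mulmx1.
- by rewrite /GRing.comm /GRing.mul /= /i scalar_mxC.
- by rewrite /GRing.comm /GRing.mul /= /i scalar_mxC.
- by rewrite /GRing.comm /GRing.mul /= /i scalar_mxC.
- rewrite /GRing.mul /= /i mul_scalar_mx -tens3Z1 -tens3D1 -twisted_path_corner //.
  by rewrite !tens3_mul twisted_path_eigen.
(* The inverses of the roots of [iota] are roots of [- iota], and inverting [w] negates the
   difference of [w] and its inverse; this yields the eigenvalue matrix [- d]. *)
- rewrite /GRing.mul /= /i mul_scalar_mx -scaleNr -tens3Z1 -tens3D1.
  rewrite -twisted_path_corner ?sqrrN // !tens3_mul !mulmx1 -tens3N1.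
  rewrite (@twisted_path_eigen _ _ (- iota)) ?oppr_eq0 // => [|k].
    rewrite -mulmxN; congr (tens3 (_ *m _) _ _); apply/matrixP => k l.
    by rewrite !mxE invrK -mulNrn opprB.
  by rewrite exprVn w1n; apply: (mulfI iota_neq0); rewrite mulfV // mulrN -expr2 iota2 opprK.
Qed.

Let V_unit : V \in unitmx.
Proof.
have e1 : e + e' = 1%:M.
  by rewrite -scalerDr addrACA addNr addr0 -mulr2n -scaler_nat scalerA mulVf // scale1r.
have ee' : e *m e' = 0.
  rewrite /e -scalemxAl mulmxBl mul1mx -scalemxAl Be' mulNmx mul_scalar_mx scalerN.
  by rewrite scalerA -expr2 iota2 scaleN1r opprK subrr scaler0.
have e'e : e' *m e = 0.
  rewrite /e' -scalemxAl mulmxDl mul1mx -scalemxAl Be mul_scalar_mx.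
  by rewrite scalerA -expr2 iota2 scaleN1r subrr scaler0.
have ee : e *m e = e by rewrite -[RHS]mulmx1 -e1 mulmxDr ee' addr0.
have e'e' : e' *m e' = e' by rewrite -[RHS]mulmx1 -e1 mulmxDr e'e add0r.
have V1_unit := Vandermonde_unit w1_inj.
have V1'_unit : V1' \in unitmx by apply: Vandermonde_unit => k l /invr_inj/w1_inj.
have fB : f *m B = B *m f by apply: comm1; rewrite ?mul1mx ?mulmx1.
have f'B : f' *m B = B *m f' by apply: comm1; rewrite ?mul1mx ?mulmx1.
have [fe fe'] := comm_e fB; have [f'e f'e'] := comm_e f'B.
pose g : 'M[C]_(n1 * n2 * n3) := tens3 (invmx V1) 1%:M 1%:M.
pose g' : 'M[C]_(n1 * n2 * n3) := tens3 (invmx V1') 1%:M 1%:M.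
have gf : g *m f = 1%:M by rewrite tens3_mul mulVmx // !mulmx1 tens3_1.
have gf' : g' *m f' = 1%:M by rewrite tens3_mul mulVmx // !mulmx1 tens3_1.
have := @spectral_left_inverse _ g g' f f' e e' gf gf'
  (esym fe) (esym fe') (esym f'e) (esym f'e') ee e'e' ee' e'e e1.
by case/mulmx1_unit.
Qed.

Let U_unit : U \in unitmx.
Proof.
have V2_unit := Vandermonde_unit w2_inj; have V3_unit := Vandermonde_unit w3_inj.
have : tens3 1%:M (invmx V2) (invmx V3) *m U = 1%:M.
  by rewrite tens3_mul !mulVmx // mulmx1 tens3_1.
by case/mulmx1_unit.
Qed.

Let N2 : 'M[C]_(n1 * n2 * n3) := tens3 1%:M (A2 *m A2) 1%:M.
Let N3 : 'M[C]_(n1 * n2 * n3) := tens3 1%:M 1%:M (A3 *m A3).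

(** Two sign changes cancel; hence the squares of [A2] and [A3] commute with the sign and reversal
    matrices that make up [B]. *)
Let comm_sqr n (X Y : 'M[C]_n) : X *m Y = - (Y *m X) -> X *m (Y *m Y) = Y *m Y *m X.
Proof. by move=> h; rewrite mulmxA h mulNmx -(mulmxA Y X) h mulmxN opprK mulmxA. Qed.

Let N2V : N2 *m V = V *m N2.
Proof.
apply: comm_V; rewrite !tens3_mul ?mulmx1 ?mul1mx //.
by rewrite (comm_sqr (rev_mx_antiperiodic C n2_even)).
Qed.

Let N3V : N3 *m V = V *m N3.
Proof.
apply: comm_V; rewrite !tens3_mul ?mulmx1 ?mul1mx // [in LHS]mulmxA.
rewrite -(comm_sqr (alt_mx_twisted_path n3_even _)) -mulmxA.
by rewrite -(comm_sqr (rev_mx_antiperiodic C n3_even)) mulmxA.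
Qed.

(** The invertible matrix [V *m U] diagonalizes all three squares: [V] turns [S *m S] into [d *m d]
    and commutes with [N2] and [N3], while [U] diagonalizes these and commutes with [d *m d]. *)
Lemma det_klein_mx :
  \det ((x ^+ 2)%:M - klein_mx *m klein_mx) =
  \prod_k1 \prod_k2 \prod_k3
    (x ^+ 2 - a1 ^+ 2 * (w1 k1 - (w1 k1)^-1) ^+ 2
     - a2 ^+ 2 * (w2 k2 - (w2 k2)^-1) ^+ 2 - a3 ^+ 2 * (w3 k3 - (w3 k3)^-1) ^+ 2).
Proof.
have A2V : A2 *m V2 = V2 *m D2 by apply: twisted_path_eigen; rewrite ?oppr_eq0 ?oner_eq0.
have A3V : A3 *m V3 = V3 *m D3 by apply: twisted_path_eigen; rewrite ?oppr_eq0 ?oner_eq0.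
pose E2 : 'M[C]_(n1 * n2 * n3) := tens3 1%:M (D2 *m D2) 1%:M.
pose E3 : 'M[C]_(n1 * n2 * n3) := tens3 1%:M 1%:M (D3 *m D3).
have N2U : N2 *m U = U *m E2.
  by rewrite !tens3_mul -mulmxA A2V !mulmxA A2V !mulmx1 mul1mx.
have N3U : N3 *m U = U *m E3.
  by rewrite !tens3_mul -mulmxA A3V !mulmxA A3V !mulmx1 mul1mx.
have ddU : d *m d *m U = U *m (d *m d).
  by rewrite !tens3_mul !mulmx1 !mul1mx.
pose dg i1 i2 i3 := x ^+ 2 - a1 ^+ 2 * (w1 i1 - (w1 i1)^-1) ^+ 2
  - a2 ^+ 2 * (w2 i2 - (w2 i2)^-1) ^+ 2 - a3 ^+ 2 * (w3 i3 - (w3 i3)^-1) ^+ 2.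
pose Dg : 'M[C]_(n1 * n2 * n3) :=
  diag_mx (\row_k dg (unidx3 k).1.1 (unidx3 k).1.2 (unidx3 k).2).
have DgE : Dg = (x ^+ 2)%:M - a1 ^+ 2 *: (d *m d) - a2 ^+ 2 *: E2 - a3 ^+ 2 *: E3.
  rewrite /d /E2 /E3 !tens3_mul !mulmx_diag !mulmx1 -!diag_const_mx !tens3_diag.
  apply/matrixP => k l; rewrite /Dg /dg !mxE; case: (k == l); rewrite ?mulr1n ?mulr0n; ring.
have LW : ((x ^+ 2)%:M - klein_mx *m klein_mx) *m (V *m U) = (V *m U) *m Dg.
  have hS : S *m S *m (V *m U) = V *m U *m (d *m d).
    by rewrite mulmxA SSV -mulmxA ddU mulmxA.
  have h2 : N2 *m (V *m U) = V *m U *m E2 by rewrite mulmxA N2V -mulmxA N2U mulmxA.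
  have h3 : N3 *m (V *m U) = V *m U *m E3 by rewrite mulmxA N3V -mulmxA N3U mulmxA.
  rewrite klein_mx_sqr -/N2 -/N3 DgE.
  move: (S *m S) (d *m d) (V *m U) (N2) (N3) (E2) (E3) hS h2 h3 => SS dd W M2 M3 L2 L3 hS h2 h3.
  rewrite !opprD !addrA !mulmxDl !mulmxDr !mulNmx !mulmxN.
  by rewrite -!scalemxAl -!scalemxAr scalar_mxC hS h2 h3.
have : \det (V *m U) != 0 by rewrite -unitfE -unitmxE unitmx_mul V_unit.
move/mulIf; apply; rewrite -det_mulmx LW det_mulmx mulrC det_diag; congr (_ * _).
rewrite pair_big pair_big (reindex (@idx3 n1 n2 n3)); last first.
  by exists (@unidx3 n1 n2 n3) => k _; rewrite ?idx3K ?unidx3K.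
by apply: eq_bigr => -[[k1 k2] k3] _; rewrite mxE idx3K.
Qed.

End KleinMatrix.

(** * The signed adjacency matrix of the Klein grid *)

Section Reindexing.
Variables (R : comPzRingType) (T : finType) (N : nat).
Variables (h : 'I_N -> T) (h' : T -> 'I_N).
Hypotheses (hK : cancel h h') (h'K : cancel h' h).

Lemma det_reindex (f : T -> T -> R) :
  \det (\matrix_(i, j) f (h i) (h j)) =
  \sum_(s : {perm T}) (-1) ^+ s * \prod_v f v (s v).
Proof.
have conj_inj (s : {perm T}) : injective (fun i => h' (s (h i))).
  by move=> i j /(can_inj h'K)/perm_inj/(can_inj hK).
have conj'_inj (s : 'S_N) : injective (fun v => h (s (h' v))).
  by move=> i j /(can_inj hK)/perm_inj/(can_inj h'K).
rewrite /determinant (reindex (fun s : {perm T} => perm (@conj_inj s))) /=; last first.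
  exists (fun s => perm (@conj'_inj s)) => s _; apply/permP => v.
    by rewrite permE /= ?permE /= ?permE !h'K.
  by rewrite permE /= ?permE /= ?permE !hK.
apply: eq_bigr => s _; congr (_ ^+ _ * _); last first.
  rewrite [RHS](reindex h) /=; last by exists h' => v _; rewrite ?hK ?h'K.
  by apply: eq_bigr => i _; rewrite !mxE permE /= h'K.
(* The sign is read off the number of orbits, and [h'] maps the orbits of [s] bijectively onto those
   of its conjugate [t]. *)
set t := perm _.
have th k i : iter k t i = h' (iter k s (h i)).
  by elim: k => [|k IH]; rewrite ?hK // !iterS IH permE /= h'K.
have Et : porbits t = [set h' @: (O : {set T}) | O in porbits s].
  apply/setP => O; apply/imsetP/imsetP => [[i _ ->]|[_ /porbitsP[v ->] ->]].
    exists (porbit s (h i)); first by apply/porbitsP; exists (h i).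
    apply/setP => j; apply/porbitP/imsetP => [[k ->]|[v /porbitP[k ->] ->]].
      exists ((s ^+ k)%g (h i)); first exact: mem_porbit.
      by rewrite !permX th.
    by exists k; rewrite !permX th.
  exists (h' v) => //; apply/setP => j.
  apply/imsetP/porbitP => [[w /porbitP[k ->] ->]|[k ->]].
    by exists k; rewrite !permX th h'K.
  by exists ((s ^+ k)%g v); rewrite ?mem_porbit // !permX th h'K.
rewrite /odd_perm Et card_imset; last exact/imset_inj/(can_inj h'K).
by rewrite card_ord -(card_ord N) (bij_eq_card (Bijective hK h'K)).
Qed.

End Reindexing.

(** * Directions of the dashed edges *)

Section OrientationSigns.
Variables (m1 m2 m3 : nat).
Hypotheses (m1_gt0 : (0 < m1)%N) (m2_gt0 : (0 < m2)%N) (m3_gt0 : (0 < m3)%N).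
Local Notation V := (klein_vertex (2 * m1) (2 * m2) (2 * m3)).
Variable o : rel V.
Hypothesis ho : klein_orientation o.
Implicit Types u v : V.

Lemma orientation_rev u v : klein_adj u v -> o u v = ~~ o v u.
Proof.
by case: ho => -[_ h] _ _ _ /h; case: (o u v); case: (o v u).
Qed.

Lemma dashed_sym u v : dashed u v = dashed v u.
Proof. by rewrite /dashed orbC. Qed.

Let first_lt : (0 < 2 * m1)%N. Proof. by rewrite muln_gt0. Qed.
Let last_lt : ((2 * m1).-1 < 2 * m1)%N. Proof. by rewrite prednK. Qed.
Let near (q : 'I_(2 * m2)) (r : 'I_(2 * m3)) : V := (Ordinal first_lt, q, r).
Let far (q : 'I_(2 * m2)) (r : 'I_(2 * m3)) : V := (Ordinal last_lt, rev_ord q, rev_ord r).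

Let near_far q r : dashed (near q r) (far q r).
Proof. by rewrite /dashed /dashed_from /= prednK // !eqxx. Qed.

(* Clockwise-oddness of the square through two neighbouring dashed edges
   determines the direction of one from that of the other. *)
Let square q r q' r' :
    solid (near q r) (near q' r') -> solid (far q' r') (far q r) ->
  o (near q' r') (far q' r') =
  (label (near q r) < label (near q' r'))%N
  (+) (label (far q' r') < label (far q r))%N (+) o (near q r) (far q r).
Proof.
case: ho => _ solidE _ cw sn sf.
have := cw _ _ _ _ sn (near_far q' r') sf; rewrite dashed_sym => /(_ (near_far q r)).
rewrite /directed_edges (solidE _ _ sn) (solidE _ _ sf).
rewrite (orientation_rev (u := far q r)); last by rewrite /klein_adj dashed_sym near_far orbT.
rewrite !oddD !oddb.
by move: (label (near q r) < _)%N (label (far _ _) < _)%N (o (near q r) _) (o _ _) => [] [] [] [].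
Qed.

(** The direction is known at the vertex labelled 1 and propagates through squares: a step in the
    second coordinate reverses it, a step in the third preserves it. *)
Let dashed_near q r : o (near q r) (far q r) = ~~ odd q.
Proof.
have hm2 : (0 < 2 * m2)%N by rewrite muln_gt0.
have hm3 : (0 < 2 * m3)%N by rewrite muln_gt0.
have cycS n (i j : 'I_n) : j = i.+1 :> nat -> cycle_adj i j /\ cycle_adj j i.
  move=> E; have h : j == ordS i.
    by apply/eqP/val_inj; rewrite /= -E modn_small.
  by rewrite /cycle_adj /cycle_mult h addn1.
have base : o (near (Ordinal hm2) (Ordinal hm3)) (far (Ordinal hm2) (Ordinal hm3)).
  case: ho => _ _ h _; apply: h; first exact: near_far.
  by rewrite /label /boustrophedon /=; lia.
(* The layers [r1] and [rev_ord r1] have opposite parity, so their rows are numbered in opposite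
   orders and exactly one of the two label comparisons in [square] holds. *)
have step2 (q1 q2 : 'I_(2 * m2)) r1 : q2 = q1.+1 :> nat ->
    o (near q2 r1) (far q2 r1) = ~~ o (near q1 r1) (far q1 r1).
  move=> E; have [c12 c21] := cycS _ _ _ E.
  have [b1 b2] : cycle_adj (rev_ord q2) (rev_ord q1) /\ cycle_adj (rev_ord q1) (rev_ord q2).
    by apply: cycS => /=; have := ltn_ord q2; lia.
  have sn : solid (near q1 r1) (near q2 r1) by rewrite /solid /solid2 /= !eqxx c12 /= ?orbT.
  have sf : solid (far q2 r1) (far q1 r1) by rewrite /solid /solid2 /= !eqxx b1 /= ?orbT.
  rewrite (square sn sf) !solid_label //= !eqxx -!val_eqE /= E.
  have -> : odd (2 * m3 - r1.+1) = ~~ odd r1 by have := ltn_ord r1; lia.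
  have := ltn_ord q2; rewrite E => ?.
  have -> : (q1 == q1.+1 :> nat) = false by lia.
  have -> : (2 * m2 - q1.+2 == 2 * m2 - q1.+1)%N = false by lia.
  case: (odd r1) => /=; case: (o _ _); lia.
(* Labels always grow with the third coordinate, so both label comparisons in [square] hold and
   cancel. *)
have step3 q1 (r1 r2 : 'I_(2 * m3)) : r2 = r1.+1 :> nat ->
    o (near q1 r2) (far q1 r2) = o (near q1 r1) (far q1 r1).
  move=> E; have [c12 c21] := cycS _ _ _ E.
  have [b1 b2] : cycle_adj (rev_ord r2) (rev_ord r1) /\ cycle_adj (rev_ord r1) (rev_ord r2).
    by apply: cycS => /=; have := ltn_ord r2; lia.
  have sn : solid (near q1 r1) (near q1 r2) by rewrite /solid /solid3 /= !eqxx c12 /= ?orbT.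
  have sf : solid (far q1 r2) (far q1 r1) by rewrite /solid /solid3 /= !eqxx b1 /= ?orbT.
  rewrite (square sn sf) !solid_label //= !eqxx -!val_eqE /= E.
  have := ltn_ord r2; rewrite E => ?.
  have -> : (r1 == r1.+1 :> nat) = false by lia.
  have -> : (2 * m3 - r1.+2 == 2 * m3 - r1.+1)%N = false by lia.
  case: (o _ _); lia.
have along3 k (hk : (k < 2 * m3)%N) :
    o (near (Ordinal hm2) (Ordinal hk)) (far (Ordinal hm2) (Ordinal hk)).
  elim: k hk => [|k IH] hk; first by rewrite (bool_irrelevance hk hm3).
  by rewrite (step3 _ (Ordinal (ltnW hk))) ?IH.
have along2 k (hk : (k < 2 * m2)%N) : o (near (Ordinal hk) r) (far (Ordinal hk) r) = ~~ odd k.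
  elim: k hk => [|k IH] hk.
    by rewrite (bool_irrelevance hk hm2); case: r => k hr; exact: along3.
  by rewrite (step2 (Ordinal (ltnW hk))) ?IH.
by case: q => k hk; exact: along2.
Qed.

(** The formula is consistent at both ends of the edge because reversal of an even range changes
    parity. *)
Lemma dashed_orientation u v : dashed u v -> o u v = ~~ odd u.1.2.
Proof.
have from_near u' v' : dashed_from u' v' -> o u' v' = ~~ odd u'.1.2.
  case: u' v' => [[p q] r] [[p' q'] r'] /and4P[/= /eqP p0 /eqP p1 /eqP -> /eqP ->].
  rewrite -(dashed_near q r); congr (o (_, _, _) (_, _, _)); apply: val_inj => //=.
  exact: (congr1 predn p1).
case/orP => h; first exact: from_near.
have hvu : dashed v u by rewrite /dashed h.
rewrite orientation_rev ?from_near //; last by rewrite /klein_adj dashed_sym hvu orbT.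
have [-> _ _] := dashedP hvu => /=.
by rewrite oddB ?ltn_ord // oddM.
Qed.

End OrientationSigns.

(** * Entries of the Klein grid matrix and the partition function as its determinant *)

Section KleinEntries.
Variables (R : realType) (m1 m2 m3 : nat).
Hypotheses (m1_gt0 : (0 < m1)%N) (m2_gt0 : (0 < m2)%N) (m3_gt0 : (0 < m3)%N).
Local Notation V := (klein_vertex (2 * m1) (2 * m2) (2 * m3)).
Variable o : rel V.
Hypothesis ho : klein_orientation o.
Variables (a1 a2 a3 : R).
Implicit Types u v : V.

Lemma ordS_eq n (i j : 'I_n) :
  (j == ordS i) = (j == i.+1 :> nat) || (j == 0 :> nat) && (i.+1 == n).
Proof.
rewrite -val_eqE /=; have hj := ltn_ord j.
have := ltn_ord i; rewrite leq_eqVlt => /orP[/eqP E|h].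
  by rewrite E modnn eqxx andbT (ltn_eqF hj).
by rewrite modn_small // (ltn_eqF h) andbF orbF.
Qed.

(** The twist -1 makes the closing edge, like all others, count +1 from the lower index to the
    higher. For [n = 2] the two parallel edges therefore add up instead of cancelling. *)
Lemma antiperiodic_cycle n (i j : 'I_n) : (1 < n)%N ->
  twisted_path n (-1) i j = (if (i < j)%N then 1 else -1) *+ cycle_mult i j :> R.
Proof.
move=> n1; rewrite mxE /cycle_mult !ordS_eq invrN1 !mulrN1 opprK -!natrM !mulnb.
have hj := ltn_ord j; have hi := ltn_ord i.
case: (ltngtP i j) => ij.
- have -> : (i == j.+1 :> nat) = false by lia.
  have -> : (i.+1 == n) && (j == 0 :> nat) = false by lia.
  have -> : (j == 0 :> nat) && (i.+1 == n) = false by lia.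
  by rewrite orbF subr0 subr0 -natrD.
- have -> : (j == i.+1 :> nat) = false by lia.
  have -> : (i == 0 :> nat) && (j.+1 == n) = false by lia.
  by rewrite orbF /= addr0 sub0r mulNrn natrD opprD addrC andbC.
- have -> : (j == i.+1 :> nat) = false by lia.
  have -> : (i == j.+1 :> nat) = false by lia.
  have -> : (i == 0 :> nat) && (j.+1 == n) = false by lia.
  have -> : (i.+1 == n) && (j == 0 :> nat) = false by lia.
  have -> : (j == 0 :> nat) && (i.+1 == n) = false by lia.
  by rewrite /= mulr0n !subr0 addr0.
Qed.

Lemma klein_mx_entry (p p' : 'I_(2 * m1)) (q q' : 'I_(2 * m2)) (r r' : 'I_(2 * m3)) :
  klein_mx (2 * m1) (2 * m2) (2 * m3) a1 a2 a3 (idx3 (p, q, r)) (idx3 (p', q', r')) =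
  a1 * ((if solid1 (p, q, r) (p', q', r') then
           (if (p < p')%N then 1 else -1) * (-1) ^+ q * (-1) ^+ r else 0)
        + (if dashed (p, q, r) (p', q', r') then (-1) ^+ q else 0))
  + a2 * (if solid2 (p, q, r) (p', q', r') then
            (if (q < q')%N then 1 else -1) *+ cycle_mult q q' * (-1) ^+ r else 0)
  + a3 * (if solid3 (p, q, r) (p', q', r') then
            (if (r < r')%N then 1 else -1) *+ cycle_mult r r' else 0) :> R.
Proof.
have hp := ltn_ord p; have hp' := ltn_ord p'.
rewrite /klein_mx mxE [in LHS]mxE [X in X + _ + _]mxE.
rewrite [X in _ * X]mxE [X in _ + X + _]mxE [X in _ + _ + X]mxE !tens3E !idx3K /=.
rewrite !antiperiodic_cycle; try lia.
congr (_ * (_ + _) + _ * _ + _ * _).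
- rewrite /solid1 /= /path_adj !mxE invr0 !mulr0 subr0 addr0.
  case: (q == q'); case: (r == r'); rewrite ?andbF ?andbT ?mul0r ?mulr0 ?mul0r ?mul1r //.
  rewrite /=; case: (ltngtP p p') => pp'.
  + have -> : (p == p'.+1 :> nat) = false by lia.
    by rewrite orbF subr0; case: eqP => _; rewrite ?mul0r.
  + have -> : (p' == p.+1 :> nat) = false by lia.
    by rewrite /= sub0r; case: eqP => _; rewrite ?oppr0 ?mul0r.
  + have -> : (p' == p.+1 :> nat) = false by lia.
    have -> : (p == p'.+1 :> nat) = false by lia.
    by rewrite subr0 !mul0r.
- have revC n (i j : 'I_n) : (i == rev_ord j) = (j == rev_ord i).
    by rewrite -{1}(rev_ordK i) (inj_eq rev_ord_inj) eq_sym.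
  rewrite mul_alt_mx !mxE /dashed /dashed_from /= (revC _ q) (revC _ r).
  case: (q' == _); case: (r' == _); rewrite ?andbF ?andbT ?mul0r ?mulr0 ?mul0r ?mulr1 //.
  rewrite -!natrM !mulnb -natrD /=.
  (* The two ends of an even path are distinct, so at most one summand is 1 and the sum is a
     disjunction. *)
  have -> : ((p.+1 == 2 * m1) && (p' == 0 :> nat) + (p == 0 :> nat) && (p'.+1 == 2 * m1) =
             (p == 0 :> nat) && (p'.+1 == 2 * m1) || (p' == 0 :> nat) && (p.+1 == 2 * m1))%N by lia.
  by case: (_ || _); rewrite ?mul1r ?mul0r.
- rewrite /solid2 /= !mxE /cycle_adj.
  case: (p == p'); case: (r == r'); rewrite ?andbF ?andbT ?mul0r ?mulr0 ?mul0r ?mul1r //=.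
  by case: cycle_mult => [|n]; rewrite ?mulr0n ?mul0r.
- rewrite /solid3 /= !mxE /cycle_adj.
  case: (p == p'); case: (q == q'); rewrite ?mul0r ?mulr0 ?mul0r ?mul1r //=.
  by case: cycle_mult.
Qed.

Lemma dashed_irrefl u : dashed u u = false.
Proof.
apply/negP => /dashedP[/(congr1 val) /= E _ _]; have := ltn_ord u.1.2.
by move: E; case: u => [[p q] r] /=; lia.
Qed.

Lemma path_adj_neq n (i j : 'I_n) : path_adj i j -> i != j.
Proof. by move=> h; apply/eqP => E; move: h; rewrite E /path_adj; lia. Qed.

(** An edge lies in exactly one of the four classes, so one summand survives. Its sign comes from
    [solid_label] for solid edges and from [dashed_orientation] for dashed ones. *)
Lemma lv_matrix_klein (x : R) u v :
  lv_matrix (@klein_adj (2 * m1) (2 * m2) (2 * m3)) o (fun=> x) (klein_weight a1 a2 a3) u v =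
  x *+ (u == v) + klein_mx (2 * m1) (2 * m2) (2 * m3) a1 a2 a3 (idx3 u) (idx3 v).
Proof.
case: u v => [[p q] r] [[p' q'] r']; rewrite klein_mx_entry /lv_matrix.
case: eqVneq => [[-> -> ->]|uv].
  rewrite dashed_irrefl; case: ifP => [/and3P[/path_adj_neq]|_]; first by rewrite eqxx.
  case: ifP => [/and3P[_ /cycle_adjP[]]|_]; first by rewrite eqxx.
  case: ifP => [/and3P[_ _ /cycle_adjP[]]|_]; first by rewrite eqxx.
  by rewrite !mulr0 !addr0 mulr0 mulr1n addr0.
rewrite mulr0n add0r /klein_adj /klein_weight /sgn.
case dash: (dashed _ _); rewrite ?orbT ?orbF.
  have := dashed_solid dash; rewrite /solid => /negbT.
  rewrite !negb_or => /and3P[/negbTE -> /negbTE -> /negbTE ->].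
  rewrite !mulr0 !addr0 add0r (dashed_orientation m1_gt0 m2_gt0 m3_gt0 ho dash) /=.
  by rewrite mulrC -signr_odd; case: (odd q).
case: ifP => [sol|]; last first.
  rewrite /solid => /negbT; rewrite !negb_or => /and3P[/negbTE -> /negbTE -> /negbTE ->].
  by rewrite !mulr0 !addr0 mulr0.
have [_ -> // _ _] := ho; rewrite solid_label //=.
case s1: (solid1 _ _).
  move: s1; rewrite /solid1 /solid2 /solid3 /= => /and3P[/[dup] padj /path_adj_neq pp' -> ->].
  rewrite (negbTE pp') /= !mulr0 !addr0 mulrC -signr_odd -(signr_odd _ r).
  move: pp'; rewrite -val_eqE /=.
  by case: (odd q); case: (odd r) => /=; case: ltngtP => //= _ _; ring.
case s2: (solid2 _ _).
  move: s2; rewrite /solid2 /solid3 /= => /and3P[-> cadj rr'].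
  have [qq' _ _] := cycle_adjP cadj; rewrite -(val_eqE q) /= (negbTE qq').
  rewrite ?andbF /= !mulr0 !addr0 ?add0r ?mulr0 add0r -(signr_odd _ r).
  by move: qq'; case: (odd r); case: ltngtP => //= _ _;
    rewrite -[in LHS]mulr_natr -[in RHS]mulr_natr; ring.
move: sol; rewrite /solid s1 s2 /= => s3; rewrite s3.
move: (s3); rewrite /solid3 /= => /and3P[_ -> radj].
have [rr' _ _] := cycle_adjP radj; rewrite -(val_eqE r) /= (negbTE rr').
rewrite !mulr0 !addr0 mulr0 !add0r.
by case: (r < r')%N; rewrite -[in LHS]mulr_natr -[in RHS]mulr_natr; ring.
Qed.

Definition klein_colour u : bool := odd (u.1.1 + u.1.2 + u.2).

Lemma klein_bipartite u v : klein_adj u v -> klein_colour u != klein_colour v.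
Proof.
case: u v => [[p q] r] [[p' q'] r']; rewrite /klein_adj /klein_colour /=.
case/orP => [/or3P[]|/dashedP[/= -> ->]].
- case/and3P => /= /orP[]/eqP -> /eqP <- /eqP <-; rewrite !oddD /=;
    by case: (odd p'); case: (odd p); case: (odd q); case: (odd r).
- case/and3P => /= /eqP <- /cycle_adjP[_ h _] /eqP <-; rewrite !oddD; move: h.
  by case: (odd p); case: (odd q); case: (odd q'); case: (odd r).
- case/and3P => /= /eqP <- /eqP <- /cycle_adjP[_ h _]; rewrite !oddD; move: h.
  by case: (odd p); case: (odd q); case: (odd r'); case: (odd r).
(* A dashed edge changes the parity of all three coordinates, hence that of their sum. *)
- have ends k l : (k == 0) && (l.+1 == 2 * m1)%N -> (odd k = false) * (odd l = true).
    by case/andP => /eqP -> /eqP E; rewrite -[odd l]negbK -oddS E oddM.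
  rewrite !oddD !oddB ?ltn_ord // !oddM /=.
  case/orP => /ends[-> ->] /=; by case: (odd q); case: (odd r).
Qed.

Lemma klein_adj_sym : symmetric (@klein_adj (2 * m1) (2 * m2) (2 * m3)).
Proof. by move=> u v; rewrite /klein_adj solidC dashed_sym. Qed.

Lemma klein_partition_function_det (x : R) :
  lv_partition_function (@klein_adj (2 * m1) (2 * m2) (2 * m3)) o (fun=> x)
    (klein_weight a1 a2 a3) =
  \det (x%:M + klein_mx (2 * m1) (2 * m2) (2 * m3) a1 a2 a3).
Proof.
have [ori _ _ _] := ho.
rewrite (lv_partition_function_perm _ _ klein_adj_sym klein_bipartite ori).
rewrite -(det_reindex (@unidx3K _ _ _) (@idx3K _ _ _)); congr (\det _).
apply/matrixP => i j; rewrite mxE lv_matrix_klein !unidx3K (can_eq (@unidx3K _ _ _)).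
by rewrite [RHS]mxE; congr (_ + _); rewrite mxE.
Qed.

End KleinEntries.

(** * Evaluation on the unit circle *)

Section UnitCircle.
Variable R : realType.
Implicit Types (s t : R).

Definition cis t : R[i] := (cos t +i* sin t)%C.

Lemma cisD s t : cis (s + t) = cis s * cis t.
Proof. by apply/eqP; rewrite eq_complex /= cosD sinD addrC eqxx addrC eqxx. Qed.

Lemma cis0 : cis 0 = 1.
Proof. by rewrite /cis cos0 sin0. Qed.

Lemma cisMn t n : cis (t *+ n) = cis t ^+ n.
Proof. by elim: n => [|n IH]; rewrite ?cis0 // mulrSr exprSr cisD IH. Qed.

Lemma cis_mulN t : cis t * cis (- t) = 1.
Proof. by rewrite -cisD subrr cis0. Qed.

Lemma cis_neq0 t : cis t != 0.
Proof. by apply: contra_eq_neq (cis_mulN t) => ->; rewrite mul0r eq_sym oner_eq0. Qed.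

Lemma cisV t : (cis t)^-1 = cis (- t).
Proof. by apply: (mulfI (cis_neq0 t)); rewrite mulfV ?cis_neq0 ?cis_mulN. Qed.

Lemma cis2pi : cis (pi *+ 2) = 1.
Proof. by rewrite /cis cos2pi sin2pi. Qed.

(** The difference is [2 i sin t]; its square is real, so the complex eigenvalue product descends to
    the reals. *)
Lemma cis_subV t : (cis t - (cis t)^-1) ^+ 2 = (- (4 * sin t ^+ 2))%:C%C.
Proof.
rewrite cisV /cis cosN sinN; apply/eqP; rewrite eq_complex /=.
by apply/andP; split; apply/eqP; ring.
Qed.

Lemma cis_neq1 t : 0 < t < pi *+ 2 -> cis t != 1.
Proof.
move=> /andP[t0 t2]; apply/negP => /eqP[+ _].
(* By the double-angle formula [cos t = 1] forces the sine of [t / 2] to vanish, but that half angle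
   lies strictly between 0 and pi. *)
have -> : t = (t / 2) *+ 2 by rewrite -mulr_natr divfK // pnatr_eq0.
rewrite cos_mulr2n => h.
have /sin_gt0_pi : 0 < t / 2 < pi by rewrite mulr2n in t2; apply/andP; split; lra.
have := cos2Dsin2 (t / 2); have {h} -> : cos (t / 2) ^+ 2 = 1 by rewrite mulr2n in h; lra.
by nra.
Qed.

Lemma cis_progression_inj (a : R) n : (0 < n)%N ->
  injective (fun k : 'I_n => cis (a + k%:R * (pi *+ 2 / n%:R))).
Proof.
move=> n0 k l E; apply/val_inj => /=.
wlog kl : k l E / (k <= l)%N.
  by move=> H; case/orP: (leq_total k l) => h; [exact: H|apply/esym/H].
apply/eqP; rewrite eqn_leq kl leqNgt; apply/negP => lk.
have np : 0 < n%:R :> R by rewrite ltr0n.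
have P0 : 0 < pi *+ 2 :> R by rewrite pmulrn_lgt0 // pi_gt0.
(* Two equal points with [k < l] would differ by an angle strictly between 0 and a full turn. *)
have : cis ((l - k)%:R * (pi *+ 2 / n%:R)) != 1.
  apply: cis_neq1; rewrite mulr_gt0 ?ltr0n ?subn_gt0 //=; last first.
    by rewrite divr_gt0.
  rewrite mulrA ltr_pdivrMr // mulrC (ltr_pM2l P0) ltr_nat.
  by rewrite (leq_ltn_trans (leq_subr _ _)).
rewrite natrB // mulrBl.
have -> : l%:R * (pi *+ 2 / n%:R) - k%:R * (pi *+ 2 / n%:R) =
  (a + l%:R * (pi *+ 2 / n%:R)) - (a + k%:R * (pi *+ 2 / n%:R)) :> R by ring.
by rewrite cisD -cisV -E mulfV ?eqxx ?cis_neq0.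
Qed.

Lemma cis_progression_exp (a : R) n k : (0 < n)%N ->
  cis (a + k%:R * (pi *+ 2 / n%:R)) ^+ n = cis (a *+ n).
Proof.
move=> n0; rewrite -cisMn mulrnDl cisD -[X in _ * cis X]mulr_natr -mulrA divfK ?pnatr_eq0 -?lt0n //.
by rewrite mulr_natl (cisMn _ k) cis2pi expr1n mulr1.
Qed.

End UnitCircle.

(** * Monic polynomials with equal squares *)

Section MonicSquares.
Variable R : numFieldType.
Implicit Types p q : {poly R}.

(** In characteristic zero the integers below [size p] are distinct, and these are more roots than a
    nonzero [p] can have. *)
Lemma poly_eq0_horner p : (forall x, p.[x] = 0) -> p = 0.
Proof.
move=> h; apply/eqP/negPn/negP => p0.
have roots : all (root p) [seq k%:R | k <- iota 0 (size p)].
  by apply/allP => y _; rewrite rootE h.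
have uniq_roots : uniq [seq k%:R : R | k <- iota 0 (size p)].
  by rewrite map_inj_uniq ?iota_uniq // => k l /eqP; rewrite eqr_nat => /eqP.
by have := max_poly_roots p0 roots uniq_roots; rewrite size_map size_iota ltnn.
Qed.

(** The product of [p - q] and [p + q] is zero, and [p = - q] would give leading coefficients 1 and
    -1. *)
Lemma monic_sqr_inj p q : p \is monic -> q \is monic ->
  (forall x, p.[x] ^+ 2 = q.[x] ^+ 2) -> p = q.
Proof.
move=> mp mq h; have /eqP : (p - q) * (p + q) = 0.
  by apply: poly_eq0_horner => x; rewrite -subr_sqr !hornerE h subrr.
rewrite mulf_eq0 subr_eq0 addr_eq0 => /orP[/eqP //|/eqP E].
have := monicP mp; rewrite E lead_coefN (monicP mq) => /eqP.
by rewrite eq_sym -subr_eq0 opprK -(natrD _ 1 1) pnatr_eq0.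
Qed.

End MonicSquares.

Lemma prod_periodic (R : comPzRingType) m (G : nat -> R) :
  (forall k, G (k + m)%N = G k) -> \prod_(k < 2 * m) G k = (\prod_(k < m) G k) ^+ 2.
Proof.
move=> h; rewrite mul2n -addnn big_split_ord /= expr2; congr (_ * _).
by apply: eq_bigr => k _; rewrite addnC h.
Qed.

(** * Evaluation of the determinant over the reals *)

Section KleinDeterminant.
Variables (R : realType) (m1 m2 m3 : nat).
Hypotheses (m1_gt0 : (0 < m1)%N) (m2_gt0 : (0 < m2)%N) (m3_gt0 : (0 < m3)%N).
Variables (a1 a2 a3 : R).

(* The angles are those of the statement with [i1 = k1 + 1], and so on: they are
   the arguments of the [2 * m1]-th roots of [- 'i] and of the [2 * m2]-th and
   [2 * m3]-th roots of -1. *)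
Let ang (a : R) m k : R := a + k%:R * (pi *+ 2 / (2 * m)%:R).
Let ang1 := ang (3 * pi / (4 * m1%:R)) m1.
Let ang2 := ang (pi / (2 * m2%:R)) m2.
Let ang3 := ang (pi / (2 * m3%:R)) m3.

Let gap k1 k2 k3 : R :=
  4 * a1 ^+ 2 * sin (ang1 k1) ^+ 2 + 4 * a2 ^+ 2 * sin (ang2 k2) ^+ 2
  + 4 * a3 ^+ 2 * sin (ang3 k3) ^+ 2.

Let K := klein_mx (2 * m1) (2 * m2) (2 * m3) a1 a2 a3.

Let det_sqr (x : R) :
  \det (x%:M + K) ^+ 2 =
  \prod_(k1 < 2 * m1) \prod_(k2 < 2 * m2) \prod_(k3 < 2 * m3) (x ^+ 2 + gap k1 k2 k3).
Proof.
have two_m m : (0 < m)%N -> (0 < 2 * m)%N by lia.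
have even2 m : ~~ odd (2 * m) by lia.
(* A square root of -1 is required, so the identity is proved after the injective embedding into the
   complex numbers. *)
rewrite det_klein_mx_sqr //; apply: complexI.
rewrite -det_map_mx map_mxB map_scalar_mx map_mxM map_klein_mx.
(* Of the two square roots of -1, this is the one whose roots have the angles
   [(4 * i1 - 1) * pi / (4 * m1)]. *)
have i2 : (- 'i)%C ^+ 2 = -1 :> R[i] by rewrite sqrrN sqr_i.
have w1n (k : 'I_(2 * m1)) : cis (ang1 k) ^+ (2 * m1) = (- 'i)%C.
  rewrite cis_progression_exp ?two_m //.
  have -> : 3 * pi / (4 * m1%:R) *+ (2 * m1) = pi / 2 + pi :> R.
    by rewrite -[LHS]mulr_natr natrM; field; rewrite !pnatr_eq0 -lt0n.
  by rewrite /cis cosDpi sinDpi cos_pihalf sin_pihalf; apply/eqP; rewrite eq_complex /= !eqxx.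
have wn m (k : 'I_(2 * m)) : (0 < m)%N -> cis (ang (pi / (2 * m%:R)) m k) ^+ (2 * m) = -1.
  move=> m0; rewrite cis_progression_exp ?two_m //.
  have -> : pi / (2 * m%:R) *+ (2 * m) = pi :> R.
    by rewrite -[LHS]mulr_natr natrM; field; rewrite !pnatr_eq0 -lt0n.
  by rewrite /cis cospi sinpi /=; apply/eqP; rewrite eq_complex /= oppr0 !eqxx.
have two0 : 2 != 0 :> R[i] by rewrite pnatr_eq0.
have := @det_klein_mx _ _ _ _ (two_m _ m1_gt0) (two_m _ m2_gt0) (two_m _ m3_gt0)
  (even2 _) (even2 _) _ _ _ _ i2 two0
  w1n (cis_progression_inj (two_m _ m1_gt0))
  (fun k => wn _ k m2_gt0) (cis_progression_inj (two_m _ m2_gt0))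
  (fun k => wn _ k m3_gt0) (cis_progression_inj (two_m _ m3_gt0)).
move=> /(_ x%:C a1%:C a2%:C a3%:C)%C; rewrite -rmorphXn => ->.
rewrite rmorph_prod; apply: eq_bigr => k1 _; rewrite rmorph_prod; apply: eq_bigr => k2 _.
rewrite rmorph_prod; apply: eq_bigr => k3 _.
rewrite !cis_subV /gap /ang1 /ang2 /ang3.
move: (sin (ang _ m1 k1)) (sin (ang _ m2 k2)) (sin (ang _ m3 k3)) => s1 s2 s3.
by rewrite -!rmorphXn -!rmorphM -!rmorphB; congr (_%:C)%C; ring.
Qed.

Let ang_periodic a m k : (0 < m)%N -> sin (ang a m (k + m)) ^+ 2 = sin (ang a m k) ^+ 2.
Proof.
move=> m0; have -> : ang a m (k + m) = ang a m k + pi.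
  by rewrite /ang natrD natrM -[pi *+ 2]mulr_natr; field; rewrite pnatr_eq0 -lt0n.
by rewrite sinDpi sqrrN.
Qed.

Let root_prod (x : R) := \prod_(k1 < m1) \prod_(k2 < m2) \prod_(k3 < m3) (x ^+ 2 + gap k1 k2 k3).

(** Adding [m] to an index adds pi to the angle and leaves the squared sine unchanged, so halving
    each of the three ranges squares the product: the exponent is 8. *)
Let det_sqr_root_prod x : \det (x%:M + K) ^+ 2 = (root_prod x ^+ 4) ^+ 2.
Proof.
rewrite det_sqr (prod_periodic (G := fun k1 =>
  \prod_(k2 < 2 * m2) \prod_(k3 < 2 * m3) (x ^+ 2 + gap k1 k2 k3))); last first.
  by move=> k; do 2!(apply: eq_bigr => ? _); rewrite /gap ang_periodic.
congr (_ ^+ 2); rewrite -prodrXl; apply: eq_bigr => k1 _.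
rewrite (prod_periodic (G := fun k2 => \prod_(k3 < 2 * m3) (x ^+ 2 + gap k1 k2 k3))).
  rewrite (exprM _ 2 2); congr (_ ^+ 2); rewrite -prodrXl; apply: eq_bigr => k2 _.
  rewrite (prod_periodic (G := fun k3 => x ^+ 2 + gap k1 k2 k3)) // => k.
  by rewrite /gap [sin (ang3 _) ^+ 2]ang_periodic.
by move=> k; apply: eq_bigr => ? _; rewrite /gap [sin (ang2 _) ^+ 2]ang_periodic.
Qed.

(** Equality of squares at a single [x] leaves the sign open, so both sides are viewed as monic
    polynomials in [x]; the left one is the characteristic polynomial of [- K]. *)
Let det_root_prod x : \det (x%:M + K) = root_prod x ^+ 4.
Proof.
pose q : {poly R} :=
  (\prod_(k1 < m1) \prod_(k2 < m2) \prod_(k3 < m3) ('X^2 + (gap k1 k2 k3)%:P)) ^+ 4.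
have q_monic : q \is monic.
  apply: monic_exp; do 3!(apply: monic_prod => ? _).
  by rewrite -[_%:P]opprK -polyCN monicXnsubC.
have pE y : (char_poly (- K)).[y] = \det (y%:M + K).
  rewrite /char_poly -horner_evalE -det_map_mx; congr (\det _).
  apply/matrixP => i j; rewrite !mxE /= horner_evalE.
  by rewrite hornerD hornerN hornerC opprK hornerMn hornerX.
have qE y : q.[y] = root_prod y ^+ 4.
  rewrite horner_exp horner_prod; congr (_ ^+ 4); apply: eq_bigr => k1 _.
  rewrite horner_prod; apply: eq_bigr => k2 _; rewrite horner_prod; apply: eq_bigr => k3 _.
  by rewrite hornerD hornerXn hornerC.
rewrite -pE -qE; congr (_.[x]); apply: monic_sqr_inj => // [|y].
  exact: char_poly_monic.
by rewrite pE qE det_sqr_root_prod.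
Qed.

Lemma det_klein_product (x : R) :
  \det (x%:M + K) =
  \prod_(1 <= i1 < m1.+1) \prod_(1 <= i2 < m2.+1) \prod_(1 <= i3 < m3.+1)
    (x ^+ 2
     + 4 * a1 ^+ 2 * sin ((4 * i1%:R - 1) * pi / (4 * m1%:R)) ^+ 2
     + 4 * a2 ^+ 2 * sin ((2 * i2%:R - 1) * pi / (2 * m2%:R)) ^+ 2
     + 4 * a3 ^+ 2 * sin ((2 * i3%:R - 1) * pi / (2 * m3%:R)) ^+ 2) ^+ 4.
Proof.
rewrite det_root_prod /root_prod -prodrXl big_add1 big_mkord; apply: eq_bigr => k1 _.
rewrite -prodrXl big_add1 big_mkord; apply: eq_bigr => k2 _.
rewrite -prodrXl big_add1 big_mkord; apply: eq_bigr => k3 _.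
have angE m k : (0 < m)%N -> (2 * k.+1%:R - 1) * pi / (2 * m%:R) = ang (pi / (2 * m%:R)) m k.
  move=> m0; rewrite /ang natrM -[pi *+ 2]mulr_natr -natr1.
  by field; rewrite pnatr_eq0 -lt0n.
rewrite !angE // /gap /ang2 /ang3 !addrA; congr ((_ + _ * sin _ ^+ 2 + _ + _) ^+ 4).
rewrite /ang1 /ang natrM -[pi *+ 2]mulr_natr -natr1.
by field; rewrite pnatr_eq0 -lt0n.
Qed.

End KleinDeterminant.

Theorem theorem5p3 (R : realType) (m1 m2 m3 : nat)
    (hm1 : (0 < m1)%N) (hm2 : (0 < m2)%N) (hm3 : (0 < m3)%N)
    (o : rel (klein_vertex (2 * m1) (2 * m2) (2 * m3)))
    (ho : klein_orientation o)
    (x a1 a2 a3 : R) :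
  lv_partition_function
    (@klein_adj (2 * m1) (2 * m2) (2 * m3)) o
    (fun _ => x) (klein_weight a1 a2 a3) =
  \prod_(1 <= i1 < m1.+1) \prod_(1 <= i2 < m2.+1) \prod_(1 <= i3 < m3.+1)
    (x ^+ 2
     + 4 * a1 ^+ 2 * sin ((4 * i1%:R - 1) * pi / (4 * m1%:R)) ^+ 2
     + 4 * a2 ^+ 2 * sin ((2 * i2%:R - 1) * pi / (2 * m2%:R)) ^+ 2
     + 4 * a3 ^+ 2 * sin ((2 * i3%:R - 1) * pi / (2 * m3%:R)) ^+ 2) ^+ 4.
Proof.
by rewrite klein_partition_function_det // det_klein_product.
Qed.
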